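(* Let $G=(V_0,S_0,\mathcal{A},h,t,\theta)$ be a simple stopping tree-like rotor graph with vertex set $V$, and let $\rho$ be a rotor configuration on $G$. Then the Destination Forest $D(\rho)$ can be computed in time $O(|V|)$.
   Context: A directed graph $(V,\mathcal{A},h,t)$ has a finite vertex set $V$, a finite arc set $\mathcal{A}$, and maps $h,t:\mathcal{A}\to V$ (head, tail), with no loops. $\mathcal{A}^+(u)$ is the set of arcs with tail $u$. It is simple if for every $u,v$ there is at most one arc with tail $u$ and head $v$. $\overline{G}$ is the simple undirected graph on $V$ in which $u,v$ are adjacent iff some arc joins them in either direction. Rotor graph $G=(V_0,S_0,\mathcal{A},h,t,\theta)$: $V=V_0\sqcup S_0$ with $S_0\neq\emptyset$ (the sinks), and for each $u\in V_0$ a rotor order $\theta_u:\mathcal{A}^+(u)\to\mathcal{A}^+(u)$ such that the orbit of every arc is all of $\mathcal{A}^+(u)$. A rotor configuration is a map $\rho:V_0\to\mathcal{A}$ with $\rho(u)\in\mathcal{A}^+(u)$. $G$ is stopping if from every vertex there is a directed path to a sink. $G$ is tree-like if $\overline{G}$ is a tree and every sink is a leaf of $\overline{G}$. Destination Forest: $G(\rho)$ is the directed graph on $V$ with arc set $\rho(V_0)$. A cycle push on a directed cycle $C$ of $G(\rho)$ replaces $\rho(u)$ by $\theta_u(\rho(u))$ for each $u\in C$ and leaves $\rho$ unchanged elsewhere. If $G$ is stopping, every sequence of cycle pushes is finite, and every maximal sequence of cycle pushes starting from $\rho$ ends in the same configuration $D(\rho)$, with $G(D(\rho))$ acyclic.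 Time is counted in elementary operations (arithmetic operations and comparisons at unit cost). *)

(* Defs.v *)
From Stdlib Require Import Relation_Operators.
From mathcomp Require Import all_boot.

Set Implicit Arguments.
Unset Strict Implicit.
Unset Printing Implicit Defensive.

(* The vertex set is the disjoint union [V0 + S0].  [rotor] gathers all the
   maps theta_u: on an arc leaving [inl u] it is theta_u.  Its values on arcs
   leaving a sink (such arcs are not excluded) are unconstrained and unused. *)
Record rotor_graph (V0 S0 A : finType) := RotorGraph {
  ahead : A -> V0 + S0;
  atail : A -> V0 + S0;
  rotor : A -> A;
  no_loop : forall a, ahead a != atail a;
  has_sink : 0 < #|S0|;
  rotorP : forall (u : V0) (a : A), atail a = inl u ->
    orbit rotor a =i [pred b | atail b == inl u]
}.

Section RotorGraph.
Variables (V0 S0 A : finType) (G : rotor_graph V0 S0 A).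
Local Notation V := (V0 + S0)%type.

Definition simple_graph : Prop :=
  forall a b : A, atail G a = atail G b -> ahead G a = ahead G b -> a = b.

Definition arc_rel : rel V :=
  fun u v => [exists a : A, (atail G a == u) && (ahead G a == v)].

Definition stopping : Prop :=
  forall v : V, exists s : S0, connect arc_rel v (inr s).

Definition adj : rel V := fun u v => arc_rel u v || arc_rel v u.

Definition is_tree (e : rel V) : Prop :=
  (forall u v, connect e u v) /\ (forall c, 2 < size c -> ~ ucycle e c).

Definition is_leaf (e : rel V) (v : V) : Prop := #|[pred w | e v w]| = 1.

Definition tree_like : Prop :=
  is_tree adj /\ (forall s : S0, is_leaf adj (inr s)).

Definition rotor_config (rho : {ffun V0 -> A}) : Prop :=
  forall u, atail G (rho u) = inl u.

(* Sinks have no outgoing arc in G(rho) and every other vertex has exactly one,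
   so a directed cycle of G(rho) is determined by its sequence of vertices,
   which all lie in V0. *)
Definition directed_cycle (rho : {ffun V0 -> A}) (c : seq V0) : Prop :=
  c != [::] /\ ucycle (fun u v => ahead G (rho u) == inl v) c.

Definition push (c : seq V0) (rho : {ffun V0 -> A}) : {ffun V0 -> A} :=
  [ffun u => if u \in c then rotor G (rho u) else rho u].

Definition cycle_push (rho rho' : {ffun V0 -> A}) : Prop :=
  exists2 c, directed_cycle rho c & rho' = push c rho.

(* [D] ends a maximal sequence of cycle pushes starting from [rho]. *)
Definition destination_forest (rho D : {ffun V0 -> A}) : Prop :=
  clos_refl_trans _ cycle_push rho D /\ forall D', ~ cycle_push D D'.

End RotorGraph.

(* A unit-cost random access machine, presented as a structured language.  The
   memory consists of arrays of natural numbers: [s x i] is the entry [i] of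
   the array [x].  Array names are static, so a program uses finitely many of
   them; indices are computed, which provides indirect addressing.  A scalar
   variable is the entry 0 of an array. *)
Definition memory := nat -> nat -> nat.

Inductive binop := Add | Sub | Mul | Div | Eq | Leq.

Inductive expr :=
| Cst of nat
| Get of nat & expr
| Op of binop & expr & expr.

Inductive cmd :=
| Skip
| Set_ of nat & expr & expr (* [Set_ x i e] is x[i] := e *)
| Seq of cmd & cmd
| If of expr & cmd & cmd
| While of expr & cmd.

(* Subtraction is truncated, and Euclidean division by 0 yields 0. *)
Definition binop_sem (o : binop) (m n : nat) : nat :=
  match o with
  | Add => m + n
  | Sub => m - n
  | Mul => m * n
  | Div => m %/ n
  | Eq => m == n
  | Leq => m <= n
  end.

Fixpoint eval (s : memory) (e : expr) : nat :=
  match e with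
  | Cst n => n
  | Get x i => s x (eval s i)
  | Op o e1 e2 => binop_sem o (eval s e1) (eval s e2)
  end.

Fixpoint cost (e : expr) : nat :=
  match e with
  | Cst _ => 1
  | Get _ i => (cost i).+1
  | Op _ e1 e2 => (cost e1 + cost e2).+1
  end.

Definition update (s : memory) (x i v : nat) : memory :=
  fun y j => if (y == x) && (j == i) then v else s y j.

(* [exec p s k s']: started in memory [s], [p] halts after [k] elementary
   operations in memory [s']. *)
Inductive exec : cmd -> memory -> nat -> memory -> Prop :=
| ExecSkip s : exec Skip s 1 s
| ExecSet x i e s :
    exec (Set_ x i e) s (cost i + cost e).+1 (update s x (eval s i) (eval s e))
| ExecSeq p q s k s' l s'' :
    exec p s k s' -> exec q s' l s'' -> exec (Seq p q) s (k + l) s''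
| ExecIf e p q s k s' :
    exec (if eval s e != 0 then p else q) s k s' ->
    exec (If e p q) s (cost e + k).+1 s'
| ExecWhileDone e p s :
    eval s e = 0 -> exec (While e p) s (cost e).+1 s
| ExecWhileStep e p s k s' l s'' :
    eval s e <> 0 -> exec p s k s' -> exec (While e p) s' l s'' ->
    exec (While e p) s (cost e + k + l).+1 s''.

(* The array with entry [f x] at the index of [x] in a numbering of [T], and
   0 outside. *)
Definition table (T : finType) (num : T -> 'I_#|T|) (f : T -> nat) (i : nat) :
    nat :=
  if [pick x | num x == i :> nat] is Some x then f x else 0.

(* Input: array 0 holds |V| and |A|; arrays 1, 2 and 3 hold the tails, heads
   and rotor successors of the arcs; array 4 holds the arcs rho(u) for u in V0;
   array 5 flags the sinks.  All the other cells are 0. *)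
Definition input_memory (V0 S0 A : finType) (G : rotor_graph V0 S0 A)
    (rho : {ffun V0 -> A}) (numV : V0 + S0 -> 'I_#|{: V0 + S0}|)
    (numA : A -> 'I_#|A|) : memory :=
  fun x i =>
    match x with
    | 0 => nth 0 [:: #|{: V0 + S0}|; #|A|] i
    | 1 => table numA (fun a => numV (atail G a)) i
    | 2 => table numA (fun a => numV (ahead G a)) i
    | 3 => table numA (fun a => numA (rotor G a)) i
    | 4 => table numV (fun v => if v is inl u then val (numA (rho u)) else 0) i
    | 5 => table numV (fun v => if v is inr _ then 1 else 0) i
    | _ => 0
    end.

(* Output: array 6 holds the arcs D(u) for u in V0. *)
Definition outputs (V0 S0 A : finType) (D : {ffun V0 -> A})
    (numV : V0 + S0 -> 'I_#|{: V0 + S0}|) (numA : A -> 'I_#|A|)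
    (s : memory) : Prop :=
  forall u : V0, s 6 (numV (inl u)) = numA (D u).

(* Main.v *)
Require Import Defs.
From Stdlib Require Import Relation_Operators Operators_Properties.
From mathcomp Require Import all_boot zify.

(**
Root the tree at an arbitrary vertex.  By acyclicity only cycles of length two
are ever pushed, so a push happens along an edge, and the subtree below an edge
acts on the rest of the graph only through the number of pushes of that edge it
can afford.  If [u] has made [t] turns, its rotor has passed through the arc of
rank [i] in its rotor order about [t / d] times; the first arc at which [u] gets
stuck is therefore the lexicographic minimum of the pairs (number of passages
the other end allows, rank of the arc).  These minima are computed from the
leaves to the root for the arcs to the children, and then from the root to the
leaves for the arc to the parent, in constant time per vertex.

That the resulting numbers of turns [r] are the right ones follows from an
abelian-type argument: if opposite arcs are passed equally often, every arc
passed has an opposite one, and the configuration reached after [r] turns has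
no cycle, then no sequence of pushes can exceed [r] and none can stop before.

The order from the leaves to the root is obtained by peeling leaves: each vertex
stores the number of its remaining neighbours and the sum of their numbers,
and for a leaf this sum is the parent.
*)

Set Implicit Arguments.
Unset Strict Implicit.
Unset Printing Implicit Defensive.

(** * Trees *)

(** The edges are exactly the pairs [v], [par v] with [v != r]; the value [par r] is arbitrary. The
    map [dep] makes [par] well founded away from the root. *)
Definition parent_map (T : finType) (e : rel T) (r : T) (par : T -> T)
    (dep : T -> nat) : Prop :=
  (forall v, v != r -> e v (par v) /\ dep (par v) < dep v) /\
  (forall u v, e u v -> u != r /\ par u = v \/ v != r /\ par v = u).

(** Take for [dep] the distance to [r] and for [par v] a neighbour closer to [r]. The parent edges
    already connect the graph, so any other edge would close a simple path of parent edges into a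
    cycle of length at least three. *)
Lemma tree_parent_map (T : finType) (e : rel T) (r : T) :
    symmetric e -> irreflexive e -> (forall u v, connect e u v) ->
    (forall c, 2 < size c -> ~ ucycle e c) ->
  exists par dep, parent_map e r par dep.
Proof.
move=> e_sym e_irr e_conn e_acyc.
have ex_dist v : exists n, [exists t : n.-tuple T, path e r t && (last r t == v)].
  have /connectP[p e_p ->] := e_conn r v.
  by exists (size p); apply/existsP; exists (in_tuple p); rewrite /= e_p eqxx.
pose dep v := ex_minn (ex_dist v).
have dep_path p : path e r p -> dep (last r p) <= size p.
  move=> e_p; rewrite /dep; case: ex_minnP => m _; apply.
  by apply/existsP; exists (in_tuple p); rewrite /= e_p eqxx.
have ex_par v : v != r -> exists w, e v w && (dep w < dep v).
  move=> v_r; rewrite {2}/dep; case: ex_minnP => m /existsP[[p /= /eqP <-]].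
  case/lastP: p => [|p x]; first by rewrite /= eq_sym (negbTE v_r).
  rewrite rcons_path last_rcons -andbA => /and3P[/dep_path le_p e_x /eqP <-] _.
  by exists (last r p); rewrite e_sym e_x size_rcons ltnS.
pose par v := odflt v [pick w | e v w && (dep w < dep v)].
have parP v : v != r -> e v (par v) /\ dep (par v) < dep v.
  move=> /ex_par[w w_v]; rewrite /par; case: pickP => [x /andP //|/(_ w)].
  by rewrite w_v.
exists par, dep; split=> // u v e_uv.
pose e' : rel T := fun x y => (x != r) && (par x == y) || (y != r) && (par y == x).
have e'_sym : symmetric e' by move=> x y; rewrite /e' orbC.
have e'_e : subrel e' e.
  move=> x y /orP[] /andP[/parP[e_x _] /eqP <-] //.
  by rewrite e_sym.
have e'_r x : connect e' x r.
  elim: {x}(dep x) {-2}x (leqnn (dep x)) => [|m IHm] x x_m; have [->//|x_r] := eqVneq x r;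
    have [_ lt_x] := parP x x_r; first by lia.
  apply: (connect_trans _ (IHm (par x) _)); last by lia.
  by apply: connect1; rewrite /e' x_r eqxx.
have : connect e' u v.
  by apply: connect_trans (e'_r u) _; rewrite (sym_connect_sym e'_sym) e'_r.
case/connectP=> p e'_p v_p; move: v_p e_uv; case/shortenP: e'_p => {p} p e'_p p_uniq _ -> e_u.
case: p e'_p p_uniq e_u => [|x [|y p]] e'_p p_uniq e_u; first by rewrite e_irr in e_u.
  by move: e'_p; rewrite /= andbT => /orP[] /andP[? /eqP ?]; [left | right].
case: (e_acyc [:: u, x, y & p]) => //; apply/andP; split=> //.
rewrite (cycle_path u) /= -/(path e u [:: x, y & p]) e_sym e_u /=.
exact: (sub_path e'_e e'_p).
Qed.

(** * Numbers of turns determining the destination forest *)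

Lemma fcycle_reachable (T : finType) (f : T -> T) (x : T) :
  exists2 y, fconnect f x y & fcycle f (orbit f y).
Proof.
have /trajectP[i i_lt i_eq] := looping_order f x.
exists (iter i f x); first exact: fconnect_iter.
apply/(orbitPcycle 3 0); exists (order f x - i).-1.
by rewrite prednK ?subn_gt0 // -iterD subnK // ltnW.
Qed.

Section Visits.
Variables (V0 S0 A : finType) (G : rotor_graph V0 S0 A) (rho : {ffun V0 -> A}).
Hypothesis rho_cfg : rotor_config G rho.
Local Notation theta := (rotor G).

Lemma tail_iter_rotor u k : atail G (iter k theta (rho u)) = inl u.
Proof.
have := fconnect_iter theta k (rho u).
by rewrite fconnect_orbit (rotorP (rho_cfg u)) => /eqP.
Qed.

(** [theta] is not assumed injective. Cyclicity holds because the orbit of the next arc again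
    exhausts the arcs leaving [u] and so contains [rho u]. *)
Lemma orbit_rotor u : fcycle theta (orbit theta (rho u)).
Proof.
rewrite -fconnect_f fconnect_orbit (rotorP (tail_iter_rotor u 1)) inE.
by rewrite rho_cfg.
Qed.

Definition outdeg u := order theta (rho u).

Lemma iter_rotor_mod u k : iter k theta (rho u) = iter (k %% outdeg u) theta (rho u).
Proof.
have per : iter (outdeg u) theta (rho u) = rho u.
  exact/(orbitPcycle 0 4)/orbit_rotor.
rewrite {1}(divn_eq k (outdeg u)) addnC iterD; congr iter.
by elim: (k %/ _) => // m IHm; rewrite mulSn addnC iterD per.
Qed.

(** A turn counts for the arc that it leaves, so the arrival at the arc reached after [r] turns does
    not count. *)
Definition visits u r a := count (fun k => iter k theta (rho u) == a) (iota 0 r).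

Lemma visitsS u r a : visits u r.+1 a = visits u r a + (iter r theta (rho u) == a).
Proof. by rewrite /visits -addn1 iotaD count_cat /= addn0. Qed.

Lemma leq_visits u r r' a : r <= r' -> visits u r a <= visits u r' a.
Proof. by move=> le_r; rewrite /visits -(subnKC le_r) iotaD count_cat leq_addr. Qed.

Lemma visits_small u i j : i < outdeg u -> j <= outdeg u ->
  visits u j (iter i theta (rho u)) = (i < j).
Proof.
move=> lt_i; elim: j => [//|j IHj lt_j]; rewrite visitsS IHj; last exact: ltnW.
suff -> : (iter j theta (rho u) == iter i theta (rho u)) = (j == i) by lia.
apply/eqP/eqP=> [|->//]; move/(congr1 (findex theta (rho u))).
by rewrite !findex_iter.
Qed.

Lemma visitsE u b i j : i < outdeg u -> j <= outdeg u ->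
  visits u (b * outdeg u + j) (iter i theta (rho u)) = b + (i < j).
Proof.
move=> lt_i le_j; elim: b => [|b IHb]; first by rewrite visits_small.
rewrite mulSn -addnA /visits iotaD count_cat -/(visits u _ _) visits_small //.
rewrite lt_i addSn; congr _.+1; rewrite -IHb /visits.
rewrite -[X in iota X]addn0 iotaDl count_map; apply: eq_count => k /=.
by rewrite [in LHS]iter_rotor_mod modnDl -iter_rotor_mod.
Qed.

End Visits.

Section Certificate.
Variables (V0 S0 A : finType) (G : rotor_graph V0 S0 A) (rho : {ffun V0 -> A}).
Hypotheses (G_simple : simple_graph G) (rho_cfg : rotor_config G rho).
Hypothesis G_acyc : forall c, 2 < size c -> ~ ucycle (adj G) c.
Local Notation theta := (rotor G).
Local Notation visits := (visits G rho).

Definition turned (y : V0 -> nat) : {ffun V0 -> A} :=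
  [ffun u => iter (y u) theta (rho u)].

Lemma turned_config y : rotor_config G (turned y).
Proof. by move=> u; rewrite ffunE tail_iter_rotor. Qed.

(** A directed cycle longer than two would be a cycle of the underlying graph, and one of length one
    would be a loop; what remains is a pair of opposite arcs. *)
Lemma directed_cycle_opp (sigma : {ffun V0 -> A}) c u :
    rotor_config G sigma -> directed_cycle G sigma c -> u \in c ->
  exists v, [/\ v \in c, ahead G (sigma u) = inl v & ahead G (sigma v) = inl u].
Proof.
move=> sigma_cfg [_ /andP[c_cyc c_uniq]] u_c.
have sz_c : size c <= 2.
  rewrite leqNgt; apply/negP => gt2; apply: (G_acyc (c := map inl c)).
    by rewrite size_map.
  apply/andP; split; last by rewrite (map_inj_uniq inl_inj).
  rewrite cycle_map; apply: sub_cycle c_cyc => x y /eqP xy /=.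
  by apply/orP; left; apply/existsP; exists (sigma x); rewrite sigma_cfg xy !eqxx.
case: c sz_c u_c c_cyc {c_uniq} => [|x [|y [|z c]]] //= _.
  rewrite andbT => _ /eqP xx; have := no_loop G (sigma x).
  by rewrite xx sigma_cfg eqxx.
rewrite !inE andbT => /orP[] /eqP -> /andP[/eqP xy /eqP yx].
  by exists y; rewrite !inE eqxx orbT.
by exists x; rewrite !inE eqxx.
Qed.

Definition opposite (u v : V0) (a b : A) : Prop :=
  [/\ atail G a = inl u, ahead G a = inl v, atail G b = inl v & ahead G b = inl u].

Definition balanced (y : V0 -> nat) : Prop :=
  forall u v a b, opposite u v a b -> visits u (y u) a = visits v (y v) b.

(** Both arcs of the pushed pair are passed once more, simultaneously. Simplicity makes the arc
    opposite to a given one unique. *)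
Lemma push_balanced y c : balanced y -> directed_cycle G (turned y) c ->
  balanced (fun u => y u + (u \in c)) /\
  push G c (turned y) = turned (fun u => y u + (u \in c)).
Proof.
move=> y_bal c_cyc; split; last first.
  by apply/ffunP=> u; rewrite !ffunE; case: (u \in c); rewrite ?addn1 ?addn0.
have half u v a b : opposite u v a b -> (u \in c) && (turned y u == a) ->
    (v \in c) && (turned y v == b).
  move=> [ta ha tb hb] /andP[u_c /eqP ua].
  have [w [w_c hu hw]] := directed_cycle_opp (turned_config y) c_cyc u_c.
  have vw : w = v by apply: (@inl_inj _ S0); rewrite -hu ua ha.
  rewrite -vw w_c; apply/eqP/G_simple; first by rewrite turned_config tb vw.
  by rewrite hw hb.
move=> u v a b ab.
have addE x d : visits x (y x + (x \in c)) d = visits x (y x) d + ((x \in c) && (turned y x == d)).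
  by rewrite ffunE; case: (x \in c); rewrite ?addn0 // addn1 visitsS.
rewrite !addE (y_bal u v a b) //; congr (_ + nat_of_bool _); apply/idP/idP.
  exact: half.
by apply: half; case: ab.
Qed.

Variable r : V0 -> nat.
Hypothesis r_bal : balanced r.
Hypothesis r_cyc : forall u k, k < r u -> exists v b,
  opposite u v (iter k theta (rho u)) b.
Hypothesis r_end : forall u v, ahead G (turned r u) = inl v ->
  ahead G (turned r v) <> inl u.

Lemma terminal_turned D' : ~ cycle_push G (turned r) D'.
Proof.
case=> -[|u c] c_cyc _; first by case: c_cyc.
have [v [_ uv vu]] := directed_cycle_opp (turned_config r) c_cyc (mem_head u c).
exact: (r_end uv vu).
Qed.

(* Otherwise some [u] of the cycle has used up its [r u] turns; its opposite
   [v] then has used the arc to [u] as often as in [r v] turns although it is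
   its current arc, so [v] is at its end too, and [turned r] has a cycle. *)
Lemma push_leq y c : balanced y -> (forall u, y u <= r u) ->
  directed_cycle G (turned y) c -> forall u, y u + (u \in c) <= r u.
Proof.
move=> y_bal y_r c_cyc u; case u_c: (u \in c); last by rewrite addn0.
rewrite addn1 ltn_neqAle y_r andbT; apply/eqP => yu.
have [v [v_c uv vu]] := directed_cycle_opp (turned_config y) c_cyc u_c.
have ab : opposite u v (turned y u) (turned y v) by split=> //; exact: turned_config.
have vis : visits v (r v) (turned y v) = visits v (y v) (turned y v).
  by rewrite -(y_bal _ _ _ _ ab) -(r_bal ab) yu.
have yv : y v = r v.
  apply/eqP; rewrite eqn_leq y_r leqNgt; apply/negP => lt_v.
  have := leq_visits G rho v (turned y v) lt_v.
  by rewrite visitsS vis ffunE eqxx addn1 ltnn.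
apply: (@r_end u v); by move: uv vu; rewrite !ffunE yu yv.
Qed.

(** A vertex with turns left will pass its current arc at least once more; by balance the opposite
    arc is passed once more too, so the other end also has turns left. Following heads therefore
    never stops and closes a directed cycle. *)
Lemma push_exists y : balanced y -> (forall u, y u <= r u) ->
  (exists u, y u < r u) -> exists c, directed_cycle G (turned y) c.
Proof.
move=> y_bal y_r [u0 lt0].
pose f u := if ahead G (turned y u) is inl v then v else u.
have stepP u : y u < r u -> ahead G (turned y u) = inl (f u) /\ y (f u) < r (f u).
  move=> lt_u; have [v [b ab]] := r_cyc lt_u.
  have [_ uv vt vh] := ab; rewrite /f ffunE uv; split=> //.
  rewrite ltn_neqAle y_r andbT; apply/eqP => yv.
  have := leq_visits G rho u (iter (y u) theta (rho u)) lt_u.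
  by rewrite visitsS (y_bal _ _ _ _ ab) (r_bal ab) eqxx yv addn1 ltnn.
have [x x0 x_cyc] := fcycle_reachable f u0.
have iterP k : y (iter k f u0) < r (iter k f u0).
  by elim: k => // k IHk; have [] := stepP _ IHk.
have lt_x z : z \in orbit f x -> y z < r z.
  rewrite -fconnect_orbit => xz; have := connect_trans x0 xz.
  by rewrite fconnect_orbit => /trajectP[k _ ->].
exists (orbit f x); split.
  by rewrite -size_eq0 size_orbit -lt0n order_gt0.
apply/andP; split; last exact: orbit_uniq.
apply: (sub_in_cycle (P := mem (orbit f x)) (e := frel f)) x_cyc; last by apply/allP.
move=> z w z_x _ /= /eqP <-; apply/eqP.
by have [] := stepP z (lt_x z z_x).
Qed.

Lemma turned0 : turned (fun=> 0) = rho.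
Proof. by apply/ffunP=> u; rewrite ffunE. Qed.

Lemma reachable_turned sigma : clos_refl_trans _ (cycle_push G) rho sigma ->
  exists y, [/\ sigma = turned y, balanced y & forall u, y u <= r u].
Proof.
move=> rho_sigma; elim: (clos_rt_rtn1 _ _ _ _ rho_sigma)
  => [|sig tau [c c_cyc ->] _ [y [sigE y_bal y_r]]].
  by exists (fun=> 0); rewrite turned0; split.
rewrite sigE in c_cyc *; have [bal ->] := push_balanced y_bal c_cyc.
by exists (fun u => y u + (u \in c)); split=> // u; apply: push_leq.
Qed.

Lemma eq_turned y : (forall u, y u <= r u) -> ~ (exists u, y u < r u) ->
  turned y = turned r.
Proof.
move=> y_r N_lt; apply/ffunP => u; rewrite !ffunE; congr iter.
apply/eqP; rewrite eqn_leq y_r leqNgt; apply/negP => lt_u.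
by apply: N_lt; exists u.
Qed.

(** Induction on the number of turns left: every push uses up at least one, as its cycle is not
    empty. *)
Lemma turned_reachable n y : balanced y -> (forall u, y u <= r u) ->
  \sum_u (r u - y u) <= n ->
  clos_refl_trans _ (cycle_push G) (turned y) (turned r).
Proof.
elim: n y => [|n IHn] y y_bal y_r le_n; case: (pickP (fun u => y u < r u)) => [u0 lt0|N_lt];
  try by rewrite (eq_turned y_r); [exact: rt_refl | case=> u; rewrite N_lt].
  by move: le_n; rewrite (bigD1 u0) //=; lia.
have [c c_cyc] : exists c, directed_cycle G (turned y) c.
  by apply: push_exists => //; exists u0.
have [bal pE] := push_balanced y_bal c_cyc.
have [c_ne _] := c_cyc.
apply: (@rt_trans _ _ _ (push G c (turned y))).
  by apply: rt_step; exists c.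
rewrite pE; apply: IHn => //; first exact: push_leq.
rewrite -ltnS; apply: leq_trans le_n.
case: c c_ne c_cyc {pE bal} => // x c _ c_cyc.
have ler := push_leq y_bal y_r c_cyc.
rewrite (bigD1 x) //= [X in _ < X](bigD1 x) //= -addSn leq_add //.
  by have := ler x; rewrite mem_head; lia.
by apply: leq_sum => z _; lia.
Qed.

(** For uniqueness, a terminal configuration reached from [rho] is some [turned y] with [y] below
    [r]; if a turn were left, [push_exists] would allow one more push. *)
Lemma destination_forest_turned : unique (destination_forest G rho) (turned r).
Proof.
split.
  split; last exact: terminal_turned.
  rewrite -{1}turned0; apply: (@turned_reachable (\sum_u r u)) => //.
  by apply: leq_sum => u _; rewrite subn0.
move=> D' [/reachable_turned[y [-> y_bal y_r]] term].
apply/esym/eq_turned => // /(push_exists y_bal y_r)[c c_cyc].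
by apply: (term (push G c (turned y))); exists c.
Qed.

End Certificate.

(** * Blocking times *)

Section Rank.
Variables (V0 S0 A : finType) (G : rotor_graph V0 S0 A) (rho : {ffun V0 -> A}).
Hypotheses (G_simple : simple_graph G) (rho_cfg : rotor_config G rho).
Local Notation V := (V0 + S0)%type.
Local Notation theta := (rotor G).

(** Ranks count from 1 along the rotor order, starting at [rho u]; 0 stands for the absence of an
    arc and is also given to arcs leaving a sink. *)
Definition rank (v w : V) : nat :=
  if v is inl u then
    if [pick a | (atail G a == inl u) && (ahead G a == w)] is Some a
    then (findex theta (rho u) a).+1 else 0
  else 0.

Lemma rank_arc u a : atail G a = inl u ->
  rank (inl u) (ahead G a) = (findex theta (rho u) a).+1.
Proof.
move=> ta; rewrite /rank; case: pickP => [b /andP[/eqP tb /eqP hb]|/(_ a)].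
  by rewrite (G_simple (a := b) (b := a)) ?ta.
by rewrite ta !eqxx.
Qed.

Lemma rank_iter u i : i < outdeg G rho u ->
  rank (inl u) (ahead G (iter i theta (rho u))) = i.+1.
Proof. by move=> lt_i; rewrite rank_arc ?tail_iter_rotor // findex_iter. Qed.

Lemma rank_gt0 v w : 0 < rank v w ->
  exists u i, [/\ v = inl u, i < outdeg G rho u, rank v w = i.+1 &
    ahead G (iter i theta (rho u)) = w].
Proof.
case: v => [u|//] pos; exists u; move: pos; rewrite /rank.
case: pickP => [a /andP[/eqP ta /eqP ha] _|//].
have a_orb : fconnect theta (rho u) a.
  by rewrite fconnect_orbit (rotorP (rho_cfg u)) inE ta.
by exists (findex theta (rho u) a); rewrite findex_max // iter_findex.
Qed.

Lemma rank_arc_rel v w : 0 < rank v w -> arc_rel G v w.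
Proof.
move/rank_gt0=> [u [i [-> _ _ <-]]]; apply/existsP.
by exists (iter i theta (rho u)); rewrite tail_iter_rotor // !eqxx.
Qed.

Lemma arc_rel_rank u w : arc_rel G (inl u) w -> 0 < rank (inl u) w.
Proof. by case/existsP=> a /andP[/eqP ta /eqP <-]; rewrite rank_arc. Qed.

Lemma rank_inj v w w' : 0 < rank v w -> rank v w = rank v w' -> w = w'.
Proof.
move=> pos eq_r; have pos' := pos; rewrite eq_r in pos'.
move: pos pos' eq_r => /rank_gt0[u [i [-> _ -> <-]]] /rank_gt0[_ [j [[<-] _ -> <-]]] [<-].
by [].
Qed.

Lemma outdeg_leq u : outdeg G rho u <= #|{: V}|.
Proof.
rewrite /outdeg -size_orbit -(size_map (ahead G)) cardE; apply: uniq_leq_size => [|? _].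
  rewrite map_inj_in_uniq ?orbit_uniq // => a b.
  rewrite !(rotorP (rho_cfg u)) !inE => /eqP ta /eqP tb.
  by apply: G_simple; rewrite ta.
by rewrite mem_enum.
Qed.

Lemma rank_leq v w : rank v w <= #|{: V}|.
Proof.
have [->//|/rank_gt0[u [i [_ lt_i -> _]]]] := posnP (rank v w).
exact: leq_trans lt_i (outdeg_leq u).
Qed.

End Rank.

Arguments rank : simpl never.

(* The minimum, where the first argument [0] stands for infinity *)
Definition minz t c := if (t == 0) || (c < t) then c else t.

Lemma minz_gt0 t c : 0 < c -> 0 < minz t c <= c.
Proof. by rewrite /minz => c_gt0; case: ifP; lia. Qed.

Lemma minz_leq t c : 0 < t -> minz t c <= t.
Proof. by rewrite /minz => t_gt0; case: ifP; lia. Qed.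

Lemma minz_cases t c : minz t c = t /\ t != 0 \/ minz t c = c.
Proof. by rewrite /minz; case: eqP => /= _; [|case: ifP => _]; auto. Qed.

Section Times.
Variables (V0 S0 A : finType) (G : rotor_graph V0 S0 A) (rho : {ffun V0 -> A}).
Hypotheses (G_simple : simple_graph G) (rho_cfg : rotor_config G rho).
Local Notation V := (V0 + S0)%type.
Local Notation n := #|{: V}|.
Local Notation rank := (rank G rho).

(* The time [b * n.+1 + i] encodes the pair of [b] full turns and the rank
   [i <= n] of the current arc; [vis t p] counts the [s < t] with [s = p]
   modulo [n.+1], the passages through the arc of rank [p] up to time [t]. *)
Definition vis (t p : nat) := (t + n - p) %/ n.+1.

(** The times equal to [p] modulo [n.+1] are [p], [n.+1 + p], and so on; more than [b] of them lie
    below [t] exactly when the one of index [b] does. *)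
Lemma vis_gt b t p : p <= n -> (b < vis t p) = (b * n.+1 + p < t).
Proof. by move=> le_p; rewrite leq_divRL // mulSn; lia. Qed.

Lemma vis_rank_gt b t v w : (b < vis t (rank v w)) = (b * n.+1 + rank v w < t).
Proof. by rewrite vis_gt // rank_leq. Qed.

Lemma vis_leq b t v w : t <= b * n.+1 + rank v w -> vis t (rank v w) <= b.
Proof. by move=> le_t; rewrite leqNgt vis_rank_gt -leqNgt. Qed.

Lemma mod_rank b v w : (b * n.+1 + rank v w) %% n.+1 = rank v w.
Proof. by rewrite modnMDl modn_small // ltnS rank_leq. Qed.

Lemma div_rank b v w : (b * n.+1 + rank v w) %/ n.+1 = b.
Proof. by rewrite divnMDl // divn_small ?addn0 // ltnS rank_leq. Qed.

Lemma visE b v w x : vis (b * n.+1 + rank v w) (rank v x) = b + (rank v x < rank v w).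
Proof.
apply/eqP; rewrite eqn_leq; apply/andP; split.
  apply: vis_leq; have := rank_leq G_simple rho_cfg v w.
  by case: ltnP => /=; rewrite ?addn1 ?addn0 ?mulSn; lia.
case: ltnP => /= lt_x; first by rewrite addn1 vis_rank_gt; lia.
rewrite addn0; case: b => // b; rewrite vis_rank_gt mulSn.
by have := rank_leq G_simple rho_cfg v x; lia.
Qed.

Variables (root : V) (par : V -> V) (dep : V -> nat).
Hypothesis parP : parent_map (adj G) root par dep.

(* [t u] is the time at which [u] is blocked, [tc u] the one at which it is
   blocked by a child, where [0] stands for infinity. *)
Variables tc t : V -> nat.

(* The largest number of times the subtree below [c] can pass through the arc
   to its parent before it needs the parent to turn further; it is unbounded
   if [finite_offer] fails. *)
Definition offer c := (rank c (par c) != 0) * vis (tc c) (rank c (par c)).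
Definition finite_offer c := (rank c (par c) == 0) || (tc c != 0).
Definition limiting c := (rank (par c) c != 0) && finite_offer c.
(** The time at which the parent stands at its arc to [c] with the offer of [c] used up. *)
Definition limit c := offer c * n.+1 + rank (par c) c.

(** This makes [tc u] the minimum of the limits of the treated children, as a bound that is
    attained. The set [done] is a parameter because this is also an invariant of the peeling
    loop. *)
Definition up_spec (done : {pred V}) : Prop :=
  (forall c, c \in done -> limiting c -> 0 < tc (par c) <= limit c) /\
  (forall u, tc u != 0 ->
     exists c, [/\ c \in done, par c = u, limiting c & tc u = limit c]).

(** How often the parent passes through its arc to [v], hence how often [v] can pass through the
    opposite arc. *)
Definition back v := (rank (par v) v != 0) * vis (t (par v)) (rank (par v) v).

Definition down_spec v : Prop :=
  t v = if (v != root) && (rank v (par v) != 0)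
        then minz (tc v) (back v * n.+1 + rank v (par v)) else tc v.

Hypothesis tcP : up_spec [pred v | v != root].
Hypothesis tP : forall v, down_spec v.

Lemma par_par_neq v : v != root -> par v != root -> par (par v) <> v.
Proof.
case: parP => par_dep _ /par_dep[_ lt_v] /par_dep[_ lt_pv] eq_v.
by rewrite eq_v in lt_pv; lia.
Qed.

Lemma t_limit c : c != root -> limiting c -> t (par c) <= limit c.
Proof.
move=> c_r c_lim; have /andP[tc_gt0 tc_le] := tcP.1 c c_r c_lim.
rewrite tP; case: ifP => // _; apply: leq_trans tc_le.
exact: minz_leq.
Qed.

Lemma vis_offer c : c != root -> limiting c ->
  vis (t (par c)) (rank (par c) c) <= offer c.
Proof. by move=> c_r c_lim; apply: vis_leq; apply: t_limit. Qed.

(** At most [back c] passages are made, since [c] is then blocked at this arc. If the children of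
    [c] block it earlier, its passages are its offer, which bounds those of the parent. *)
Lemma back_vis c : c != root -> rank c (par c) != 0 ->
  vis (t c) (rank c (par c)) = back c.
Proof.
move=> c_r p_up; have tE := tP c; rewrite /down_spec c_r p_up /= in tE.
apply/eqP; rewrite eqn_leq; apply/andP; split.
  apply: vis_leq; rewrite tE.
  have c_gt0 : 0 < back c * n.+1 + rank c (par c) by lia.
  by case/andP: (minz_gt0 (tc c) c_gt0).
case bE : (back c) => [//|b]; rewrite vis_rank_gt tE.
have [[-> tc_n0]|->] := minz_cases (tc c) (back c * n.+1 + rank c (par c)); last first.
  by rewrite bE mulSn; lia.
rewrite -vis_rank_gt; suff : back c <= offer c by rewrite bE /offer p_up mul1n.
rewrite /back; have [->//|p_dn] := eqVneq (rank (par c) c) 0; rewrite mul1n.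
by apply: vis_offer => //; rewrite /limiting p_dn /finite_offer tc_n0 orbT.
Qed.

Lemma vis_opposite v w : 0 < rank v w -> 0 < vis (t v) (rank v w) ->
  0 < rank w v /\ vis (t v) (rank v w) = vis (t w) (rank w v).
Proof.
move=> p_vw vis_gt0.
have vw : adj G v w by rewrite /adj (rank_arc_rel rho_cfg p_vw).
case: (parP.2 _ _ vw) => [[v_r wE]|[w_r vE]].
  have := back_vis v_r; rewrite wE -lt0n => /(_ p_vw) visE1.
  move: vis_gt0; rewrite visE1 /back wE; case: (posnP (rank w v)) => [->|p_wv] //= _.
  by rewrite mul1n.
(* Without an opposite arc the offer of [w] is 0, so the parent is blocked before its first passage,
   against [vis_gt0]. *)
have p_wv : 0 < rank w v.
  rewrite lt0n -{1}vE; apply/negP => p0.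
  have := vis_offer w_r; rewrite /limiting /finite_offer p0 vE -lt0n p_vw /=.
  by rewrite /offer p0 mul0n => /(_ isT); lia.
by have := back_vis w_r; rewrite vE -lt0n p_wv /back vE -lt0n p_vw mul1n => ->.
Qed.

Inductive infinite_below (u : V) : V -> Prop :=
| InfiniteRoot : infinite_below u u
| InfiniteChild c : infinite_below u (par c) -> c != root ->
    ~~ finite_offer c -> infinite_below u c.

Hypothesis G_stopping : stopping G.

(* If [t u = 0], the set of the vertices in [infinite_below u] is closed under
   arcs and contains no sink. *)
Lemma t_gt0 u : 0 < t (inl u).
Proof.
rewrite lt0n; apply/eqP => tu0.
have tcu0 : tc (inl u) = 0 /\ ~~ ((inl u != root) && (rank (inl u) (par (inl u)) != 0)).
  move: tu0; rewrite tP; case: ifP => [/andP[_ p_up]|_ ->] //.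
  set c := (_ + _) => min0; have c_gt0 : 0 < c by rewrite /c; lia.
  by have := minz_gt0 (tc (inl u)) c_gt0; rewrite min0.
have below w : infinite_below (inl u) w -> tc w = 0 /\ exists w0, w = inl w0.
  case=> [|c _ _]; first by split; [case: tcu0 | exists u].
  rewrite /finite_offer negb_or negbK => /andP[p_up /eqP ->]; split=> //.
  by move: p_up; rewrite -lt0n => /(rank_gt0 rho_cfg)[w0 [_ [-> _ _ _]]]; exists w0.
have closed w x : infinite_below (inl u) w -> arc_rel G w x -> infinite_below (inl u) x.
  move=> w_u wx; have [tcw0 [w0 w0E]] := below w w_u.
  have p_wx : rank w x != 0 by rewrite w0E -lt0n arc_rel_rank // -w0E.
  have adj_wx : adj G w x by rewrite /adj wx.
  (* An arc up from [u] is excluded by [tcu0], and one from a lower vertex leads back into the set.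
     An arc down leads to a child of infinite offer, as a finite one would make [tc w] positive. *)
  case: (parP.2 _ _ adj_wx) => [[w_r xE]|[x_r wE]].
    case: w_u w_r xE p_wx => [|c c_u _ _ _ <- //] u_r xE p_wx.
    by case: tcu0 => _; rewrite u_r xE p_wx.
  apply: InfiniteChild => //; first by rewrite wE.
  apply/negP => x_fin; have := tcP.1 x x_r.
  by rewrite /limiting wE p_wx x_fin tcw0 => /(_ isT).
have [s /connectP[p p_path sE]] := G_stopping (inl u).
have : infinite_below (inl u) (inr s).
  rewrite {}sE; elim/last_ind: p p_path => [|p x IHp]; first by constructor.
  rewrite rcons_path last_rcons => /andP[/IHp]; exact: closed.
by case/below=> _ [].
Qed.

(** Each term of the minimum is attained at an existing arc, to a limiting child or to the parent.
    In the latter case the last clause is vacuous, the parent of [v] being no child of [v]. *)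
Lemma t_rank v : 0 < t v -> exists b w,
  [/\ 0 < rank v w, t v = b * n.+1 + rank v w &
     w != root -> par w = v -> limiting w /\ t v = limit w].
Proof.
have tc_case : 0 < tc v -> t v = tc v -> exists b w,
  [/\ 0 < rank v w, t v = b * n.+1 + rank v w &
     w != root -> par w = v -> limiting w /\ t v = limit w].
  rewrite lt0n => /(tcP.2 v)[c [c_r cE c_lim ->]] ->; exists (offer c), c.
  by rewrite -cE lt0n; split=> //; case/andP: c_lim.
have := tP v; rewrite /down_spec; case: ifP => [/andP[v_r p_up]|_] tE t_gt0; last first.
  by apply: tc_case; rewrite -tE.
case: (minz_cases (tc v) (back v * n.+1 + rank v (par v))); rewrite -tE.
  by case=> tE2; rewrite -lt0n => /tc_case; apply.
move=> ->; exists (back v), (par v); rewrite lt0n; split=> // pv_r pvE.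
by case: (par_par_neq v_r pv_r).
Qed.

(** If the parent is blocked at [v], it is so after exactly [offer v] passages, so some child blocks
    [v] no later than the arc to the parent would. The two times differ because distinct arcs have
    distinct ranks, so [v] is blocked at the child. *)
Lemma t_opposite_parent v b b' : v != root -> 0 < rank (par v) v -> 0 < rank v (par v) ->
  t (par v) = b * n.+1 + rank (par v) v -> t v <> b' * n.+1 + rank v (par v).
Proof.
move=> v_r p_dn p_up tpE tvE.
have tp_gt0 : 0 < t (par v) by lia.
have [b1 [w [p_w tpE1 w_lim]]] := t_rank tp_gt0.
have wE : w = v.
  apply: (rank_inj rho_cfg p_w); rewrite -(mod_rank b1) -tpE1 tpE.
  by rewrite mod_rank.
subst w; have [/andP[_ v_fin] tpE2] := w_lim v_r erefl.
have off_b : offer v = b.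
  by rewrite -(div_rank b (par v) v) -tpE tpE2 div_rank.
have tc_gt0 : tc v != 0 by move: v_fin; rewrite /finite_offer eqn0Ngt p_up.
have back_b : back v = b by rewrite /back -lt0n p_dn mul1n tpE visE ltnn addn0.
have tc_le : tc v <= b * n.+1 + rank v (par v).
  by rewrite leqNgt -vis_rank_gt; move: off_b; rewrite /offer -lt0n p_up mul1n => ->; lia.
have [c [c_r cE c_lim tcE]] := tcP.2 v tc_gt0.
have mod_tc : tc v %% n.+1 = rank v c by rewrite tcE /limit cE mod_rank.
have p_c : 0 < rank v c by move: c_lim; rewrite /limiting cE -lt0n => /andP[].
have c_up : rank v c <> rank v (par v).
  move/(rank_inj rho_cfg p_c) => cpv.
  by apply: (par_par_neq c_r); rewrite cE // cpv.
have := tP v; rewrite /down_spec v_r -lt0n p_up /= back_b.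
case: (minz_cases (tc v) (b * n.+1 + rank v (par v))) => [[-> _] tvE2|minE _].
  by apply: c_up; rewrite -mod_tc -tvE2 tvE mod_rank.
have tcE3 : tc v = b * n.+1 + rank v (par v).
  by have := @minz_leq (tc v) (b * n.+1 + rank v (par v)); lia.
by apply: c_up; rewrite -mod_tc tcE3 mod_rank.
Qed.

(** Converts an encoded time into single turns, [outdeg G rho u] of which make a full turn. Ranks
    start at 1, hence the predecessor. *)
Definition turns u := t (inl u) %/ n.+1 * outdeg G rho u + (t (inl u) %% n.+1).-1.

Lemma t_turns u : exists b j, [/\ j < outdeg G rho u,
  t (inl u) = b * n.+1 + rank (inl u) (ahead G (iter j (rotor G) (rho u))),
  t (inl u) %% n.+1 = j.+1 &
  turns u = b * outdeg G rho u + j].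
Proof.
have [b [w [p_w tE _]]] := t_rank (t_gt0 u).
have [_ [j [[<-] lt_j rE wE]]] := rank_gt0 rho_cfg p_w.
by exists b, j; rewrite wE /turns tE div_rank mod_rank rE.
Qed.

(** Single turns and encoded times meet the arcs of [u] in the same order: both counts are the
    number of full turns, plus one for the arcs met before the current one. *)
Lemma visits_turns u a : atail G a = inl u ->
  visits G rho u (turns u) a = vis (t (inl u)) (rank (inl u) (ahead G a)).
Proof.
move=> ta; have [b [j [lt_j tE _ ->]]] := t_turns u.
have a_gt0 : 0 < rank (inl u) (ahead G a) by rewrite rank_arc.
have a_orb : fconnect (rotor G) (rho u) a.
  by rewrite fconnect_orbit (rotorP (rho_cfg u)) inE ta.
rewrite tE visE rank_iter // rank_arc // ltnS -{1}(iter_findex a_orb).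
by rewrite visitsE // ?findex_max // ltnW.
Qed.

Lemma turnedE u : turned G rho turns u = iter (t (inl u) %% n.+1).-1 (rotor G) (rho u).
Proof.
have [b [j [lt_j _ modE tE]]] := t_turns u.
by rewrite ffunE modE tE iter_rotor_mod // modnMDl modn_small.
Qed.

Lemma destination_forest_turns :
  (forall c, 2 < size c -> ~ ucycle (adj G) c) ->
  unique (destination_forest G rho) (turned G rho turns).
Proof.
move=> G_acyc; have [parD parA] := parP; apply: destination_forest_turned => //.
(* If either count is positive, [vis_opposite] applies from that end; otherwise both are zero. *)
- have half u v a b : opposite G u v a b -> 0 < visits G rho u (turns u) a ->
      visits G rho u (turns u) a = visits G rho v (turns v) b.
    move=> [ta ha tb hb]; rewrite !visits_turns // ha hb => vis_gt0.
    have p_uv : 0 < rank (inl u) (inl v) by rewrite -ha rank_arc.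
    by have [_ ->] := vis_opposite p_uv vis_gt0.
  move=> u v a b ab; have ba : opposite G v u b a by case: ab.
  have [a0|/half] := posnP (visits G rho u (turns u) a); last by apply.
  by have [b0|/half] := posnP (visits G rho v (turns v) b); [rewrite a0 | move=> <-].
(* A turn is a passage through its arc, and an arc that is passed has an opposite one. *)
- move=> u k lt_k; set a := iter k _ _.
  have ta : atail G a = inl u by apply: tail_iter_rotor.
  have vis_gt0 : 0 < visits G rho u (turns u) a.
    apply: leq_trans (leq_visits G rho u a lt_k).
    by rewrite visitsS eqxx addn1.
  have p_a : 0 < rank (inl u) (ahead G a) by rewrite rank_arc.
  rewrite visits_turns // in vis_gt0.
  have [/(rank_gt0 rho_cfg)[v [i [vE _ _ iE]]] _] := vis_opposite p_a vis_gt0.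
  exists v, (iter i (rotor G) (rho v)); split=> //; exact: tail_iter_rotor.
(* One of two adjacent vertices is the parent of the other, so [t_opposite_parent] applies, up to
   exchanging them. *)
- have no_opp u v : ahead G (turned G rho turns u) = inl v ->
      ahead G (turned G rho turns v) = inl u -> v != u ->
      inl v != root -> par (inl v) = inl u -> False.
    rewrite !turnedE.
    have [b [j [lt_j tE -> _]]] := t_turns u; have [b' [j' [lt_j' tE' -> _]]] := t_turns v.
    move=> /= uv vu _ v_r vE; rewrite uv in tE; rewrite vu in tE'.
    apply: (@t_opposite_parent (inl v) b b') => //; rewrite vE //.
      by rewrite -uv rank_iter.
    by rewrite -vu rank_iter.
  move=> u v uv vu; have tD w := turned_config rho_cfg turns w.
  have neq : v != u.
    apply/eqP => vE; have := no_loop G (turned G rho turns u).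
    by rewrite tD uv vE eqxx.
  have adj_uv : adj G (inl u) (inl v).
    rewrite /adj; apply/orP; left; apply/existsP.
    by exists (turned G rho turns u); rewrite tD uv !eqxx.
  case: (parA _ _ adj_uv) => -[x_r xE]; last exact: (no_opp u v).
  by apply: (no_opp v u) => //; rewrite eq_sym.
Qed.

End Times.

(** * Time bounds for programs *)

Fixpoint straight (p : cmd) : bool :=
  match p with
  | Skip | Set_ _ _ _ => true
  | Seq p q | If _ p q => straight p && straight q
  | While _ _ => false
  end.

Fixpoint run (p : cmd) (s : memory) : memory :=
  match p with
  | Set_ x i e => update s x (eval s i) (eval s e)
  | Seq p q => run q (run p s)
  | If e p q => if eval s e != 0 then run p s else run q s
  | Skip | While _ _ => s
  end.

(** Both branches of a conditional are counted, so that the bound does not depend on the memory. *)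
Fixpoint time (p : cmd) : nat :=
  match p with
  | Skip => 1
  | Set_ _ i e => (cost i + cost e).+1
  | Seq p q => time p + time q
  | If e p q => (cost e + (time p + time q)).+1
  | While e p => (cost e + time p).+1
  end.

Fixpoint writes (p : cmd) : seq nat :=
  match p with
  | Skip => [::]
  | Set_ x _ _ => [:: x]
  | Seq p q | If _ p q => writes p ++ writes q
  | While _ p => writes p
  end.

Definition agree_off (xs : seq nat) (s s' : memory) : Prop :=
  forall x i, x \notin xs -> s' x i = s x i.

Lemma exec_run p s : straight p -> exists2 k, exec p s k (run p s) & k <= time p.
Proof.
elim: p s => [|x i e|p IHp q IHq|e p IHp q IHq|//] s /=.
- by exists 1; first exact: ExecSkip.
- by exists (cost i + cost e).+1; first exact: ExecSet.
- move=> /andP[/(IHp s)[k pk le_k] /(IHq (run p s))[l ql le_l]].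
  by exists (k + l); [exact: ExecSeq pk ql | exact: leq_add].
- move=> /andP[/(IHp s)[k pk le_k] /(IHq s)[l ql le_l]].
  case: ifP => c; [exists (cost e + k).+1 | exists (cost e + l).+1]; try by lia.
    by apply: ExecIf; rewrite c.
  by apply: ExecIf; rewrite c.
Qed.

Lemma exec_agree p s k s' : exec p s k s' -> agree_off (writes p) s s'.
Proof.
elim=> {p s k s'} //=.
- move=> x i e s y j; rewrite inE => /negbTE y_x; by rewrite /update y_x.
- by move=> p q s k s' l s'' _ IHp _ IHq y j; rewrite mem_cat => /norP[yp yq]; rewrite IHq // IHp.
- move=> e p q s k s' _ IHp y j; rewrite mem_cat => /norP[yp yq]; apply: IHp.
  by case: ifP.
- by move=> e p s k s' l s'' _ _ IHp _ IHq y j y_p; rewrite IHq // IHp.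
Qed.

Lemma run_agree p s : straight p -> agree_off (writes p) s (run p s).
Proof. by case/(exec_run s) => k /exec_agree. Qed.

(** A Hoare triple with a time bound. The frame condition is built in so that facts about arrays not
    written by [p] survive in a sequence. *)
Definition halts (p : cmd) (s : memory) (K : nat) (Q : memory -> Prop) : Prop :=
  exists k s', [/\ exec p s k s', k <= K & agree_off (writes p) s s' /\ Q s'].

Lemma halts_straight p s Q : straight p -> Q (run p s) -> halts p s (time p) Q.
Proof.
move=> p_str Qs; have [k pk le_k] := exec_run s p_str; exists k, (run p s); split=> //.
by split=> //; exact: run_agree.
Qed.

Lemma halts_seq p q s K L Q Q' : halts p s K Q ->
    (forall s', agree_off (writes p) s s' -> Q s' -> halts q s' L Q') ->
  halts (Seq p q) s (K + L) Q'.
Proof.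
move=> [k [s' [pk le_k [fr Qs]]]] /(_ s' fr Qs)[l [s'' [ql le_l [_ Qs'']]]].
have e : exec (Seq p q) s (k + l) s'' by exact: ExecSeq pk ql.
exists (k + l), s''; split=> //; first exact: leq_add.
by split=> //; exact: exec_agree e.
Qed.

(** The measure bounds the number of iterations; the additional unit pays for the final test. *)
Lemma halts_while e p s0 (I : memory -> Prop) (mu : memory -> nat) :
    straight p -> I s0 ->
    (forall s, agree_off (writes p) s0 s -> I s -> eval s e != 0 ->
       I (run p s) /\ mu (run p s) < mu s) ->
  halts (While e p) s0 ((mu s0).+1 * (cost e + time p).+1)
    (fun s => I s /\ eval s e = 0).
Proof.
move=> p_str I0 step.
have loop m s : agree_off (writes p) s0 s -> I s -> mu s <= m ->
    exists k s', [/\ exec (While e p) s k s', k <= m.+1 * (cost e + time p).+1 &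
      I s' /\ eval s' e = 0].
  elim: m s => [|m IHm] s fr Is mu_s; have [e0|e0] := eqVneq (eval s e) 0;
    try by exists (cost e).+1, s; split=> //; [exact: ExecWhileDone | lia].
    by have [_] := step s fr Is e0; lia.
  have [Ir mur] := step s fr Is e0.
  have [k pk le_k] := exec_run s p_str.
  have fr' : agree_off (writes p) s0 (run p s).
    by move=> y j y_p; rewrite run_agree // fr.
  have [||l [s' [wl le_l Q]]] := IHm (run p s) fr' => //; first by lia.
  exists (cost e + k + l).+1, s'; split=> //; last by lia.
  by apply: ExecWhileStep wl => //; apply/eqP.
have [//|k [s' [wk le_k Q]]] := loop (mu s0) s0 _ I0 (leqnn _).
by exists k, s'; split=> //; split=> //; exact: (exec_agree wk).
Qed.

Lemma halts_leq p s K L (Q Q' : memory -> Prop) : K <= L ->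
    (forall s', agree_off (writes p) s s' -> Q s' -> Q' s') ->
  halts p s K Q -> halts p s L Q'.
Proof.
move=> le_KL QQ' [k [s' [pk le_k [fr Qs]]]]; exists k, s'; split=> //.
  exact: leq_trans le_KL.
by split=> //; exact: QQ'.
Qed.

(** * The program *)

Lemma table_num (T : finType) (num : T -> 'I_#|T|) (f : T -> nat) x :
  injective num -> table num f (num x) = f x.
Proof.
move=> num_inj; rewrite /table; case: pickP => [y /eqP/val_inj/num_inj -> //|/(_ x)].
by rewrite eqxx.
Qed.

Lemma num_surj (T : finType) (num : T -> 'I_#|T|) i :
  injective num -> i < #|T| -> exists x, val (num x) = i.
Proof.
move=> num_inj lt_i; have [|f _ fK] := inj_card_bij num_inj; first by rewrite card_ord.
by exists (f (Ordinal lt_i)); rewrite fK.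
Qed.

Lemma cell_eq N i i' j j' : j < N -> j' < N ->
  (i * N + j == i' * N + j') = (i == i') && (j == j').
Proof.
move=> lt_j lt_j'; apply/eqP/andP=> [e|[/eqP-> /eqP->] //].
have := congr1 (modn^~ N) e; have := congr1 (divn^~ N) e.
rewrite /= !modnMDl !divnMDl ?(leq_ltn_trans _ lt_j) // !divn_small // !modn_small //.
by rewrite !addn0 => -> ->.
Qed.

Arguments update s x i v y j /.

Local Notation Var x := (Get x (Cst 0)).
Local Notation SetVar x e := (Set_ x (Cst 0) e).
Local Notation Vcount := (Var 0).
Local Notation Acount := (Get 0 (Cst 1)).
Local Notation Cell i j := (Op Add (Op Mul i (Op Add Vcount (Cst 1))) j).
Local Notation Incr x i e := (Set_ x i (Op Add (Get x i) e)).
Local Notation Decr x i e := (Set_ x i (Op Defs.Sub (Get x i) e)).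

(* Array 7 is the adjacency matrix; 8 and 9 hold the degrees and the sums of the
   neighbours among the unpeeled vertices; 10 holds the ranks and 11 the arcs of
   given rank; 12 and 13 hold the times [tc] and [t]; 14 holds the parents and
   15 the peeling order.  Arrays from 16 on are scalars.  The matrices rely on
   the memory being zero initially. *)
Definition arcs_body : cmd :=
  let t := Get 1 (Var 16) in
  let h := Get 2 (Var 16) in
  Seq (If (Get 7 (Cell h t)) Skip
         (Seq (Seq (Incr 8 t (Cst 1)) (Incr 8 h (Cst 1)))
              (Seq (Incr 9 t h) (Incr 9 h t))))
      (Seq (Set_ 7 (Cell t h) (Cst 1)) (Incr 16 (Cst 0) (Cst 1))).

Definition arcs_cond : expr := Op Leq (Op Add (Var 16) (Cst 1)) Acount.

Definition arcs_loop : cmd := While arcs_cond arcs_body.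

(** Variable 17 holds the vertex, 18 its current arc and 19 the number of its arcs ranked so far. A
    nonzero rank at the current arc shows that the rotor has come round; sinks are left at once. *)
Definition walk_body : cmd :=
  let P := Cell (Var 17) (Get 2 (Var 18)) in
  If (Op Mul (Op Eq (Get 5 (Var 17)) (Cst 0)) (Op Eq (Get 10 P) (Cst 0)))
     (Seq (Seq (Incr 19 (Cst 0) (Cst 1)) (Set_ 10 P (Var 19)))
          (Seq (Set_ 11 (Cell (Var 17) (Var 19)) (Var 18)) (SetVar 18 (Get 3 (Var 18)))))
     (Seq (Incr 17 (Cst 0) (Cst 1)) (Seq (SetVar 18 (Get 4 (Var 17))) (SetVar 19 (Cst 0)))).

Definition walk_cond : expr := Op Leq (Op Add (Var 17) (Cst 1)) Vcount.

Definition walk_loop : cmd := Seq (SetVar 18 (Get 4 (Cst 0))) (While walk_cond walk_body).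

(** * Correctness of the first two loops: degrees, neighbour sums and ranks *)

Section Machine.
Variables (V0 S0 A : finType) (G : rotor_graph V0 S0 A) (rho : {ffun V0 -> A}).
Local Notation V := (V0 + S0)%type.
Local Notation n := #|{: V}|.
Variables (numV : V -> 'I_n) (numA : A -> 'I_#|A|).
Hypotheses (numV_inj : injective numV) (numA_inj : injective numA).
Hypotheses (G_simple : simple_graph G) (rho_cfg : rotor_config G rho).

Definition vid v : nat := numV v.
Definition aid a : nat := numA a.

Lemma vid_eq v w : (vid v == vid w) = (v == w).
Proof. exact: (inj_eq (inj_comp val_inj numV_inj)). Qed.

Lemma aid_eq a b : (aid a == aid b) = (a == b).
Proof. exact: (inj_eq (inj_comp val_inj numA_inj)). Qed.

Lemma vid_lt v : vid v < n. Proof. exact: ltn_ord. Qed.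

Definition cell v w := vid v * n.+1 + vid w.

Lemma cellE v w v' w' : (cell v w == cell v' w') = (v == v') && (w == w').
Proof. by rewrite cell_eq ?vid_eq // ltnW // ltnS vid_lt. Qed.

Record input_ok (s : memory) : Prop := InputOk {
  in_n : s 0 0 = n;
  in_m : s 0 1 = #|A|;
  in_tail : forall a, s 1 (aid a) = vid (atail G a);
  in_head : forall a, s 2 (aid a) = vid (ahead G a);
  in_rotor : forall a, s 3 (aid a) = aid (rotor G a);
  in_rho : forall u, s 4 (vid (inl u)) = aid (rho u);
  in_sink : forall v, s 5 (vid v) = (if v is inr _ then 1 else 0)
}.

Lemma input_memory_ok : input_ok (input_memory G rho numV numA).
Proof. by split=> //= *; rewrite (table_num _ _ numV_inj) || rewrite (table_num _ _ numA_inj). Qed.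

Lemma input_ok_agree xs s s' : all (fun x => x \notin xs) (iota 0 6) ->
  agree_off xs s s' -> input_ok s -> input_ok s'.
Proof.
move=> xsP fr [s_n s_m s_t s_h s_r s_rho s_s].
have frE x i : x < 6 -> s' x i = s x i
  by move=> lt_x; apply: fr; apply: (allP xsP); rewrite mem_iota.
by split=> *; rewrite frE.
Qed.

Definition arc_before i u v := [exists a, [&& aid a < i, atail G a == u & ahead G a == v]].
Definition adj_before i u v := arc_before i u v || arc_before i v u.


Lemma arc_beforeS a u v : arc_before (aid a).+1 u v =
  arc_before (aid a) u v || (u == atail G a) && (v == ahead G a).
Proof.
apply/existsP/orP=> [[b /and3P[]]|[/existsP[b /and3P[lt_b tb hb]]|/andP[/eqP-> /eqP->]]].
- rewrite ltnS leq_eqVlt aid_eq => /predU1P[-> /eqP-> /eqP->|lt_b tb hb].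
    by right; rewrite !eqxx.
  by left; apply/existsP; exists b; rewrite lt_b tb hb.
- by exists b; rewrite ltnW ?tb ?hb.
- by exists a; rewrite leqnn !eqxx.
Qed.

Lemma arc_before_self a : arc_before (aid a) (atail G a) (ahead G a) = false.
Proof.
apply/existsP=> -[b /and3P[lt_b /eqP tb /eqP hb]].
by move: lt_b; rewrite (G_simple tb hb) ltnn.
Qed.

Lemma arc_before_all u v : arc_before #|A| u v = arc_rel G u v.
Proof. by apply: eq_existsb => a; rewrite /aid ltn_ord. Qed.

(** Reading [a] creates an edge unless the opposite arc was read before; [a] itself was not, by
    simplicity. The weight [f] is 1 for the degrees and [vid] for the sums of neighbours. *)
Lemma sum_adj_beforeS a v (f : V -> nat) :
  \sum_(w | adj_before (aid a).+1 v w) f w =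
  if arc_before (aid a) (ahead G a) (atail G a) then \sum_(w | adj_before (aid a) v w) f w
  else \sum_(w | adj_before (aid a) v w) f w +
    ((v == atail G a) * f (ahead G a) + (v == ahead G a) * f (atail G a)).
Proof.
have adjS u w : adj_before (aid a).+1 u w = [|| adj_before (aid a) u w,
    (u == atail G a) && (w == ahead G a) | (u == ahead G a) && (w == atail G a)].
  rewrite /adj_before !arc_beforeS [_ && (u == _)]andbC.
  by rewrite -!orbA; congr orb; rewrite orbCA.
case: ifP => opp.
  apply: eq_bigl => w; rewrite adjS; apply/or3P/idP=> [[//||]|->]; last by constructor 1.
    by move=> /andP[/eqP-> /eqP->]; rewrite /adj_before opp orbT.
  by move=> /andP[/eqP-> /eqP->]; rewrite /adj_before opp.
have neq := no_loop G a; have self := arc_before_self a.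
rewrite big_mkcond /= (eq_bigr (fun w => (if adj_before (aid a) v w then f w else 0) +
   ((if w == ahead G a then (v == atail G a) * f w else 0) +
    (if w == atail G a then (v == ahead G a) * f w else 0)))) => [|w _].
  by rewrite !big_split /= -!big_mkcond /= !big_pred1_eq.
have new1 : (v == atail G a) && (w == ahead G a) -> adj_before (aid a) v w = false.
  by move=> /andP[/eqP-> /eqP->]; rewrite /adj_before self opp.
have new2 : (v == ahead G a) && (w == atail G a) -> adj_before (aid a) v w = false.
  by move=> /andP[/eqP-> /eqP->]; rewrite /adj_before self opp.
have new12 : ~~ ((v == atail G a) && (v == ahead G a)).
  by apply/andP=> -[/eqP-> /eqP tE]; rewrite -tE eqxx in neq.
rewrite adjS; move: new1 new2 new12.
case: (v == atail G a); case: (v == ahead G a); case: (w == ahead G a);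
  case: (w == atail G a); case: adj_before => //= new1 new2 new12;
  by rewrite ?mul1n ?addn0 //; move: (new1 isT) || move: (new2 isT).
Qed.

Definition arcs_inv (s : memory) : Prop :=
  [/\ s 16 0 <= #|A|,
      forall u v, s 7 (cell u v) = arc_before (s 16 0) u v,
      forall v, s 8 (vid v) = \sum_(w | adj_before (s 16 0) v w) 1 &
      forall v, s 9 (vid v) = \sum_(w | adj_before (s 16 0) v w) vid w].

Lemma arcs_step s : input_ok s -> arcs_inv s -> s 16 0 < #|A| ->
  arcs_inv (run arcs_body s) /\ run arcs_body s 16 0 = (s 16 0).+1.
Proof.
move=> s_in [le_i Ws Ds Ss] lt_i; have [a /esym aE] := num_surj numA_inj lt_i.
rewrite -/(aid a) in aE; rewrite aE in lt_i le_i Ws Ds Ss.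
have neq := no_loop G a.
have Wnew u v : (if cell u v == vid (atail G a) * n.+1 + vid (ahead G a) then 1
    else s 7 (cell u v)) = arc_before (aid a).+1 u v.
  rewrite -/(cell _ _) cellE arc_beforeS Ws; case: ifP => //=; by rewrite ?orbT ?orbF.
have s7 : s 7 (vid (ahead G a) * n.+1 + vid (atail G a)) =
    arc_before (aid a) (ahead G a) (atail G a) by rewrite Ws.
rewrite /arcs_body /=.
case: ifP => /=; rewrite /arcs_inv /= aE !(in_n s_in) !(in_tail s_in) !(in_head s_in) !addn1 s7;
  case opp: arc_before => //= _; split=> //; split=> // v;
  rewrite sum_adj_beforeS opp -?Ds -?Ss //.
  rewrite !vid_eq; case: (eqVneq v (ahead G a)) => [->|_]; rewrite ?(negbTE neq) //=; first by lia.
  by case: eqP => [->|_]; lia.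
rewrite !vid_eq; case: (eqVneq v (ahead G a)) => [->|_]; rewrite ?(negbTE neq) //=; first by lia.
by case: eqP => [->|_]; lia.
Qed.

Lemma arcs_halts s : input_ok s -> s 16 0 = 0 -> (forall i, s 7 i = 0) ->
    (forall i, s 8 i = 0) -> (forall i, s 9 i = 0) ->
  halts arcs_loop s (#|A|.+1 * (cost arcs_cond + time arcs_body).+1)
    (fun s' => (forall v, s' 8 (vid v) = \sum_(w | adj G v w) 1) /\
               (forall v, s' 9 (vid v) = \sum_(w | adj G v w) vid w)).
Proof.
move=> s_in i0 W0 D0 S0'.
have bef0 u v : arc_before 0 u v = false by apply/existsP=> -[a].
have inv0 : arcs_inv s.
  rewrite /arcs_inv i0; split=> // [u v|v|v]; rewrite ?W0 ?D0 ?S0' ?bef0 // big_pred0 //.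
    by move=> w; rewrite /adj_before !bef0.
  by move=> w; rewrite /adj_before !bef0.
have := @halts_while arcs_cond arcs_body s arcs_inv
  (fun s => #|A| - s 16 0) isT inv0.
rewrite i0 subn0 => H; apply: halts_leq (leqnn _) _ (H _).
  move=> s' fr [[le_i _ Ds Ss] ]; have in' : input_ok s' by exact: (input_ok_agree _ fr s_in).
  rewrite /= (in_m in') => e0; have iE : s' 16 0 = #|A| by move: e0; case: leqP => //; lia.
  by split=> v; rewrite (Ds, Ss) iE; apply: eq_bigl => w; rewrite /adj_before !arc_before_all.
move=> s' fr inv; have in' : input_ok s' by exact: (input_ok_agree _ fr s_in).
move=> lt_i; have lt_i' : s' 16 0 < #|A| by move: lt_i; rewrite /= (in_m in') addn1; case: leqP.
have [? ->] := arcs_step in' inv lt_i'; by split=> //; lia.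
Qed.

Local Notation rank := (rank G rho).
Local Notation theta := (rotor G).

Definition vdeg (v : V) := if v is inl u then outdeg G rho u else 0.

Lemma rank_vdeg v w : rank v w <= vdeg v.
Proof.
have [->//|/(rank_gt0 rho_cfg)[u [i [-> lt_i -> _]]]] := posnP (rank v w).
exact: lt_i.
Qed.

Definition filled (s : memory) v :=
  if vid v < s 17 0 then vdeg v else if vid v == s 17 0 then s 19 0 else 0.

Definition walk_inv (s : memory) : Prop :=
  [/\ s 17 0 <= n,
      forall v w, s 10 (cell v w) = if rank v w <= filled s v then rank v w else 0,
      forall u i, i < filled s (inl u) ->
        s 11 (vid (inl u) * n.+1 + i.+1) = aid (iter i theta (rho u)) &
      forall v, vid v = s 17 0 -> s 19 0 <= vdeg v /\
        (forall u, v = inl u -> s 18 0 = aid (iter (s 19 0) theta (rho u)))].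

(** A vertex takes one step per arc to be ranked and one to move on. *)
Definition walk_measure (s : memory) :=
  \sum_(v | s 17 0 <= vid v) (vdeg v).+1 - s 19 0.

Lemma walk_step s : input_ok s -> walk_inv s -> s 17 0 < n ->
  walk_inv (run walk_body s) /\ walk_measure (run walk_body s) < walk_measure s.
Proof.
move=> s_in [le_c Ps Rs cur] lt_c; have [v vE] : exists v, vid v = s 17 0 by exact: num_surj.
have [le_j aE] := cur v vE.
have fill_v : filled s v = s 19 0 by rewrite /filled vE ltnn eqxx.
have sum_gt : s 19 0 < \sum_(w | s 17 0 <= vid w) (vdeg w).+1.
  by rewrite (bigD1 v) ?vE //=; lia.
rewrite /walk_body /=.
(* While arcs are left, the rank of the current one exceeds [s 19 0] and its cell is still 0.
   Afterwards the rotor is back at [rho u], whose rank 1 is recorded. For a sink [vdeg] is 0. *)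
have -> : ((s 5 (s 17 0) == 0) * (s 10 (s 17 0 * (s 0 0 + 1) + s 2 (s 18 0)) == 0) != 0)
    = (s 19 0 < vdeg v).
  rewrite -vE (in_sink s_in); case: v vE le_j aE fill_v {sum_gt} => [u|x] vE /= le_j aE fill_v //.
  rewrite (aE u) // (in_head s_in) (in_n s_in) addn1 -/(cell _ _) Ps fill_v mul1n.
  case: (ltnP (s 19 0) (outdeg G rho u)) => [lt_j|ge_j].
    by rewrite rank_iter // ltnn.
  have jE : s 19 0 = outdeg G rho u by lia.
  rewrite iter_rotor_mod // {1 3}jE modnn rank_iter ?order_gt0 //.
  by rewrite jE order_gt0.
case: ifP => lt_j.
  case: v vE le_j aE fill_v lt_j => [u|//] vE le_j aE fill_v lt_j; rewrite {}(aE u erefl).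
  rewrite (in_head s_in) (in_rotor s_in) (in_n s_in) !addn1 -vE -/(cell _ _).
  set a := iter (s 19 0) theta (rho u); set s1 := update _ 18 0 _.
  have fill1 w : filled s1 w = if w == inl u then (s 19 0).+1 else filled s w.
    by rewrite /filled /s1 /= -vE vid_eq; case: eqVneq => [->|//]; rewrite ltnn.
  split; last first.
    have -> : walk_measure s1 = \sum_(w | s 17 0 <= vid w) (vdeg w).+1 - (s 19 0).+1 by [].
    by rewrite /walk_measure; move: sum_gt; set S := \sum_(w | _) _; lia.
  split=> // [v w|u' i|v vE']; rewrite ?fill1.
  - rewrite /s1 /= cellE Ps; case: eqVneq => [->|//] /=.
    have rk_a : rank (inl u) (ahead G a) = (s 19 0).+1 by rewrite rank_iter.
    rewrite fill_v; case: eqVneq => [->|w_a]; first by rewrite rk_a leqnn.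
    have -> // : (rank (inl u) w <= (s 19 0).+1) = (rank (inl u) w <= s 19 0).
    rewrite leq_eqVlt ltnS -rk_a; case: eqP => //= rkE; case/eqP: w_a.
    by apply: (rank_inj rho_cfg) (rkE); rewrite rkE rk_a.
  - have lt_ju : s 19 0 < outdeg G rho u by [].
    move=> lt_i; have lt_i' : i < outdeg G rho u'.
      move: lt_i; case: eqVneq => [[->]|_] /=; first by lia.
      by move=> lt_i; apply: leq_trans lt_i _; rewrite /filled;
        do 2!case: ifP => //; move=> /eqP /cur[].
    have le_n := outdeg_leq G_simple rho_cfg u; have le_n' := outdeg_leq G_simple rho_cfg u'.
    rewrite /s1 /= cell_eq ?vid_eq ?(inj_eq inl_inj) ?eqSS;
      try by rewrite ltnS; exact: leq_trans le_n || exact: leq_trans le_n'.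
    move: lt_i; rewrite (inj_eq inl_inj); have [->|_] := eqVneq u' u => lt_i; last exact: Rs.
    rewrite /=; case: eqVneq => [->//|i_j]; apply: Rs; rewrite fill_v; lia.
  - have -> : v = inl u by apply/eqP; rewrite -vid_eq vE' vE.
    by split=> // u' [<-].
have jE : s 19 0 = vdeg v by lia.
rewrite !addn1; set s1 := update _ 19 0 _.
(* Moving on ranks nothing: [v] is complete and the next vertex starts at 0. *)
have fill1 w : filled s1 w = filled s w.
  rewrite /filled /s1 /= -vE ltnS; case: ltngtP => [//|lt_v|].
    by case: ifP.
  by move/eqP; rewrite vid_eq => /eqP ->.
split.
  split=> // [w w'|u i|w wE]; rewrite ?fill1; [exact: Ps | exact: Rs |].
  split=> // u wu; rewrite /s1 /= -(in_rho s_in); by rewrite -wu wE.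
have -> : walk_measure s1 = \sum_(w | (s 17 0).+1 <= vid w) (vdeg w).+1.
  by rewrite /walk_measure subn0.
rewrite /walk_measure [in X in _ < X](bigD1 v) ?vE //=.
rewrite [X in _ < _ + X - _](eq_bigl (fun w => (s 17 0).+1 <= vid w)) => [|w].
  by set S := \sum_(w | _) _; lia.
by rewrite -vE -vid_eq [RHS]ltn_neqAle andbC eq_sym.
Qed.

Lemma outdegE u : outdeg G rho u = #|[pred a | atail G a == inl u]|.
Proof.
rewrite /outdeg -size_orbit -(card_uniqP (orbit_uniq _ _)).
by apply: eq_card => a; rewrite (rotorP (rho_cfg u)).
Qed.

(** Double counting of the arcs by their tails; only an inequality, since arcs may leave sinks. *)
Lemma sum_vdeg_leq : \sum_v vdeg v <= #|A|.
Proof.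
rewrite big_sumType /= [X in _ + X]big1 // addn0.
rewrite (eq_bigr (fun u => \sum_(a | atail G a == inl u) 1)) => [|u _]; last first.
  by rewrite outdegE sum1_card.
rewrite (exchange_big_dep predT) //= -sum1_card leq_sum // => a _.
rewrite sum1_card; case: (atail G a) => [u|x].
  by rewrite (eq_card (B := pred1 u)) ?card1 // => u'; apply/eqP/eqP=> [[->]|->].
by rewrite eq_card0.
Qed.

Lemma walk_halts s : input_ok s -> 0 < n -> s 17 0 = 0 -> s 19 0 = 0 -> (forall i, s 10 i = 0) ->
  halts walk_loop s (time (SetVar 18 (Get 4 (Cst 0))) +
      (#|A| + n).+1 * (cost walk_cond + time walk_body).+1)
    (fun s' => (forall v w, s' 10 (cell v w) = rank v w) /\
      (forall u i, i < outdeg G rho u ->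
        s' 11 (vid (inl u) * n.+1 + i.+1) = aid (iter i theta (rho u)))).
Proof.
move=> s_in n_gt0 c0 j0 P0.
apply: halts_seq.
  apply: (@halts_straight _ _ (fun s' => walk_inv s' /\ walk_measure s' <= #|A| + n)) => //.
  split; last first.
    rewrite /walk_measure /= c0 j0 subn0 (eq_bigr (fun v => vdeg v + 1));
      last by move=> *; rewrite addn1.
    by rewrite big_split /= sum1_card leq_add2r sum_vdeg_leq.
  have fill0 v : filled (update s 18 0 (s 4 0)) v = 0.
    by rewrite /filled /= c0 j0; case: ifP.
  split=> [|v w|u i|v]; rewrite /= ?c0 ?fill0 // ?j0.
    by rewrite P0; case: rank.
  by move=> v0; split=> // u vE; rewrite -(in_rho s_in) -vE v0.
move=> s1 fr1 [inv1 mu1]; have in1 : input_ok s1 by exact: (input_ok_agree _ fr1 s_in).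
have H := @halts_while walk_cond walk_body s1 walk_inv walk_measure isT inv1.
apply: halts_leq _ _ (H _); first by rewrite leq_mul2r ltnS mu1 orbT.
  move=> s' fr [[le_c Ps Rs _]]; have in' : input_ok s' by exact: (input_ok_agree _ fr in1).
  rewrite /= (in_n in') addn1 => /eqP; rewrite eqb0 -leqNgt => ge_c.
  have fillE v : filled s' v = vdeg v.
    by rewrite /filled (leq_trans (vid_lt v)).
  by split=> [v w|u i lt_i]; [rewrite Ps fillE rank_vdeg | rewrite Rs // fillE].
move=> s' fr inv; have in' : input_ok s' by exact: (input_ok_agree _ fr in1).
move=> lt_c; apply: walk_step => //.
by move: lt_c; rewrite /= (in_n in') addn1; case: leqP.
Qed.

End Machine.

(** * Peeling leaves and computing [tc] from the leaves to the root *)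

Lemma sum_single (T : finType) (P : pred T) (f : T -> nat) y :
  \sum_(w | P w) 1 = 1 -> P y -> \sum_(w | P w) f w = f y.
Proof.
rewrite sum1_card => /eqP/card1P[z Pz] Py.
have P_z w : P w = (w == z) by exact: (Pz w).
by rewrite (eq_bigl _ _ P_z) big_pred1_eq; move: Py; rewrite P_z => /eqP ->.
Qed.

Lemma sum_cons (T : finType) (P : pred T) (f : T -> nat) (x : T) (l : seq T) : x \notin l ->
  \sum_(w | P w && (w \notin l)) f w = P x * f x + \sum_(w | P w && (w \notin x :: l)) f w.
Proof.
move=> x_l; case Px: (P x).
  rewrite (bigD1 x) ?Px // mul1n; congr addn; apply: eq_bigl => w.
  by rewrite inE negb_or; case: (P w) => //=; rewrite andbC.
rewrite mul0n add0n; apply: eq_bigl => w; rewrite inE negb_or.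
by case: eqVneq => // ->; rewrite Px.
Qed.

Definition vis_expr t q := Op Div (Op Defs.Sub (Op Add t Vcount) q) (Op Add Vcount (Cst 1)).
(** Serves both passes: it evaluates [limit] on the way up and, on the way down, the time at which
    the arc to the parent blocks. *)
Definition key t q r :=
  Op Add (Op Mul (Op Mul (Op Defs.Sub (Cst 1) (Op Eq q (Cst 0))) (vis_expr t q))
                 (Op Add Vcount (Cst 1))) r.
Definition lower x i e :=
  If (Op Add (Op Eq (Get x i) (Cst 0)) (Op Leq (Op Add e (Cst 1)) (Get x i)))
     (Set_ x i e) Skip.

Definition peel_leaf : cmd :=
  Seq (SetVar 23 (Get 9 (Var 21)))
   (Seq (Seq (Set_ 14 (Var 21) (Var 23))
           (Seq (Set_ 15 (Var 22) (Var 21)) (Incr 22 (Cst 0) (Cst 1))))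
     (Seq (Set_ 8 (Var 21) (Cst 0)) (Seq (Decr 8 (Var 23) (Cst 1)) (Decr 9 (Var 23) (Var 21))))).

Definition load_ranks : cmd :=
  Seq (SetVar 24 (Get 10 (Cell (Var 23) (Var 21)))) (SetVar 25 (Get 10 (Cell (Var 21) (Var 23)))).

Definition raise_limit : cmd :=
  Seq load_ranks
    (If (Op Mul (Var 24) (Op Add (Op Eq (Var 25) (Cst 0)) (Get 12 (Var 21))))
        (Seq (SetVar 26 (key (Get 12 (Var 21)) (Var 25) (Var 24))) (lower 12 (Var 23) (Var 26)))
        Skip).

(** Variable 20 scans the vertices and 21 is the one examined. After peeling a leaf its parent is
    examined next: it alone may have become a leaf, and the scan may be past it. The comparison with
    1 protects the root, numbered 0. *)
Definition peel_body : cmd :=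
  If (Op Mul (Op Eq (Get 8 (Var 21)) (Cst 1)) (Op Leq (Cst 1) (Var 21)))
     (Seq peel_leaf (Seq raise_limit (SetVar 21 (Var 23))))
     (Seq (Incr 20 (Cst 0) (Cst 1)) (SetVar 21 (Var 20))).

Definition peel_cond : expr := Op Leq (Op Add (Var 20) (Cst 1)) Vcount.

Definition peel_loop : cmd := While peel_cond peel_body.

Section Peel.
Variables (V0 S0 A : finType) (G : rotor_graph V0 S0 A) (rho : {ffun V0 -> A}).
Local Notation V := (V0 + S0)%type.
Local Notation n := #|{: V}|.
Variables (numV : V -> 'I_n) (numA : A -> 'I_#|A|).
Hypotheses (numV_inj : injective numV) (numA_inj : injective numA).
Hypotheses (G_simple : simple_graph G) (rho_cfg : rotor_config G rho).
Variables (root : V) (par : V -> V) (dep : V -> nat).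
Hypothesis parP : parent_map (adj G) root par dep.
Local Notation vid := (vid numV).
Local Notation cell := (cell numV).
Local Notation rank := (rank G rho).
Local Notation input_ok := (input_ok G rho numV numA).
Local Notation up_spec l tc := (up_spec G rho par tc l).
Hypothesis root0 : vid root = 0.

(** A limit depends only on the [tc] of its own vertex. The parent of [x] is untreated, so changing
    its value preserves all limits recorded so far, and the minimum at [par x] takes in one more
    term. *)
Lemma up_spec_cons (l : seq V) tc tc' x : up_spec (mem l) tc -> x \notin l -> par x \notin x :: l ->
    (forall v, v != par x -> tc' v = tc v) ->
    tc' (par x) = (if limiting G rho par tc x
                   then minz (tc (par x)) (limit G rho par tc x) else tc (par x)) ->
  up_spec (mem (x :: l)) tc'.
Proof.
move=> [tc_le tc_ex] x_l px_l tc'_off tc'_px.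
have same c : c \in x :: l -> tc' c = tc c.
  by move=> c_l; apply: tc'_off; apply: contraNneq px_l => <-.
have lim_same c : c \in x :: l -> limiting G rho par tc' c = limiting G rho par tc c.
  by move=> c_l; rewrite /limiting /finite_offer same.
have limit_same c : c \in x :: l -> limit G rho par tc' c = limit G rho par tc c.
  by move=> c_l; rewrite /limit /offer same.
split=> [c c_l|u].
  rewrite lim_same // limit_same // => c_lim.
  have lim_gt0 : 0 < limit G rho par tc c.
    by move: c_lim; rewrite /limiting /limit => /andP[]; lia.
  move: c_l; rewrite inE => /predU1P[cx|c_l].
    by subst c; rewrite tc'_px c_lim minz_gt0.
  have /andP[tc_gt0 le_c] := tc_le c c_l c_lim.
  have [pc|pc] := eqVneq (par c) (par x); last by rewrite tc'_off // tc_gt0.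
  rewrite pc tc'_px -pc; case: ifP => [x_lim|_]; last by rewrite tc_gt0.
  have x_gt0 : 0 < limit G rho par tc x.
    by move: x_lim; rewrite /limiting /limit => /andP[]; lia.
  by have := minz_gt0 (tc (par c)) x_gt0; have := minz_leq (limit G rho par tc x) tc_gt0; lia.
have [ux|ux] := eqVneq u (par x).
  rewrite ux tc'_px; case: ifP => x_lim; last first.
    move=> /tc_ex[c [c_l cp c_lim ->]]; have c_xl : c \in x :: l by rewrite inE c_l orbT.
    by exists c; rewrite limit_same // lim_same.
  have [[-> ] _|-> _] := minz_cases (tc (par x)) (limit G rho par tc x); last first.
    by exists x; rewrite inE eqxx limit_same ?lim_same ?mem_head.
  move=> /tc_ex[c [c_l cp c_lim ->]]; have c_xl : c \in x :: l by rewrite inE c_l orbT.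
  by exists c; rewrite limit_same // lim_same.
rewrite tc'_off // => /tc_ex[c [c_l cp c_lim ->]]; have c_xl : c \in x :: l by rewrite inE c_l orbT.
by exists c; rewrite limit_same // lim_same.
Qed.

Lemma adjC : symmetric (adj G).
Proof. by move=> v w; rewrite /adj orbC. Qed.

Definition unpeeled_sum (l : seq V) (f : V -> nat) v := \sum_(w | adj G v w && (w \notin l)) f w.

(* The peeled vertices are listed in [l], the last one first. *)
Record peeled (s : memory) (l : seq V) : Prop := Peeled {
  peeled_uniq : uniq l;
  peeled_root : root \notin l;
  peeled_par : forall v, v \notin l -> v != root -> par v \notin l;
  peeled_order : pairwise (fun v w => par v != w) l;
  peeled_deg : forall v, s 8 (vid v) = if v \in l then 0 else unpeeled_sum l (fun=> 1) v;
  peeled_nbr : forall v, v \notin l -> s 9 (vid v) = unpeeled_sum l vid v;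
  peeled_size : s 22 0 = size l;
  peeled_nth : forall i, i < size l -> s 15 i = vid (nth root (rev l) i);
  peeled_parent : forall v, v \in l -> s 14 (vid v) = vid (par v)
}.

(** The unpeeled vertices behind the scan are not leaves, except perhaps the one examined. At the
    end variable 21 holds [n], the number of no vertex, and the exception disappears. *)
Definition peel_pos (s : memory) (l : seq V) : Prop :=
  [/\ s 20 0 <= n,
      if s 20 0 < n then exists x, vid x = s 21 0 else s 21 0 = n &
      forall w, w \notin l -> w != root -> vid w <= s 20 0 -> vid w != s 21 0 ->
        s 8 (vid w) != 1].

Definition ranks_ok (s : memory) := forall v w, s 10 (cell v w) = rank v w.

Lemma raise_limitP s x y : input_ok s -> ranks_ok s -> y = par x ->
    s 21 0 = vid x -> s 23 0 = vid y ->
  let tc v := s 12 (vid v) in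
  (forall v, v != y -> run raise_limit s 12 (vid v) = tc v) /\
  run raise_limit s 12 (vid y) =
    if limiting G rho par tc x then minz (tc y) (limit G rho par tc x) else tc y.
Proof.
move=> s_in s_rk yE s_u s_p tc; rewrite /raise_limit /=.
rewrite s_u s_p !(in_n s_in) !addn1 -/(cell _ _) -/(cell _ _) !s_rk.
have -> : (rank y x * ((rank x y == 0) + s 12 (vid x)) != 0) = limiting G rho par tc x.
  by rewrite /limiting /finite_offer -yE muln_eq0 negb_or addn_eq0 eqb0 negb_and negbK.
case: ifP => lim; last by split.
have -> : (1 - (rank x y == 0)) * ((s 12 (vid x) + n - rank x y) %/ n.+1) * n.+1 + rank y x
    = limit G rho par tc x.
  by rewrite /limit /offer /vis -yE; case: eqP.
rewrite addn_eq0 !eqb0 negb_and !negbK /minz -/(tc y).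
split=> [v v_y|]; case: ifP => //= _; last by rewrite eqxx.
by rewrite vid_eq // (negbTE v_y).
Qed.

(** The parent of an unpeeled vertex is unpeeled, so it is the only remaining neighbour of [x];
    removing [x] changes the counters of no other remaining vertex. *)
Lemma peel_leafP s l x : peeled s l -> s 21 0 = vid x -> x != root -> s 8 (vid x) = 1 ->
  let s1 := run peel_leaf s in
  [/\ x \notin l, par x \notin x :: l, s1 23 0 = vid (par x), peeled s1 (x :: l) &
    forall v, v != x -> v != par x -> s1 8 (vid v) = s 8 (vid v)].
Proof.
move=> [l_uniq root_l l_par l_ord deg nbr sz s_nth s_par] s_u x_r x_deg.
have [par_adj adj_par] := parP; have [x_adj lt_dep] := par_adj x x_r.
have x_l : x \notin l by apply/negP=> x_l; move: x_deg; rewrite deg x_l.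
have sum1 : unpeeled_sum l (fun=> 1) x = 1 by move: x_deg; rewrite deg (negbTE x_l).
have y_l : par x \notin l by exact: l_par.
have xy : x != par x by apply: contraTneq lt_dep => <-; rewrite ltnn.
have s_p : s 9 (vid x) = vid (par x).
  by rewrite nbr //; apply: (sum_single _ sum1); rewrite /= x_adj y_l.
have nbr_x v : v \notin l -> adj G v x -> v = par x.
  move=> v_l vx; apply/eqP; move/eqP: (sum1); rewrite /unpeeled_sum sum1_card => /card1P[z zP].
  have zE w : w \notin l -> adj G x w -> w = z.
    have zP' : adj G x w && (w \notin l) = (w == z) by exact: (zP w).
    by move=> w_l xw; apply/eqP; rewrite -zP' xw w_l.
  by rewrite (zE v v_l) 1?(zE (par x)) // adjC.
rewrite /peel_leaf /= s_u s_p; split=> //.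
- by rewrite inE negb_or eq_sym xy.
- split=> /=.
  + by rewrite x_l.
  + by rewrite inE negb_or eq_sym x_r.
  (* A remaining vertex [v] with parent [x] would be the remaining neighbour [par x], making [x] and
     [par x] parents of each other. *)
  + move=> v; rewrite !inE !negb_or => /andP[v_x v_l] v_r; rewrite (l_par v v_l v_r) andbT.
    apply/eqP => pvx; have [vx _] := par_adj v v_r; rewrite pvx in vx.
    have vE := nbr_x v v_l vx; rewrite vE in pvx v_r.
    exact: (par_par_neq parP x_r v_r).
  + by rewrite l_ord andbT; apply/allP=> w w_l; apply: contraNneq y_l => ->.
  + move=> v; rewrite !vid_eq // inE (eq_sym (par x)) (negbTE xy) !deg (negbTE y_l).
    have [->|vy] := eqVneq v (par x).
      rewrite (eq_sym _ x) (negbTE xy) (negbTE y_l) /= /unpeeled_sum (sum_cons _ _ x_l).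
      by rewrite adjC x_adj mul1n addKn.
    have [//|vx] := eqVneq v x; rewrite /=; case: ifP => // v_l.
    rewrite /unpeeled_sum (sum_cons _ _ x_l); case vx' : (adj G v x) => //.
    by rewrite (nbr_x v) ?v_l ?eqxx in vy.
  + move=> v; rewrite !vid_eq // inE negb_or => /andP[v_x v_l].
    rewrite nbr // nbr // /unpeeled_sum !(sum_cons _ _ x_l).
    have [->|vy] := eqVneq v (par x).
      rewrite adjC x_adj.
      by rewrite mul1n addKn.
    by case vx' : (adj G v x) => //; rewrite (nbr_x v) ?eqxx in vy.
  + by rewrite sz addn1.
  + move=> i; rewrite ltnS sz rev_cons nth_rcons size_rev.
    case: ltngtP => // lt_i _; exact: s_nth.
  + move=> v; rewrite vid_eq // inE; case: eqVneq => [->//|_] /=; exact: s_par.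
- by move=> v v_x v_y; rewrite /= !vid_eq // (negbTE v_x) (negbTE v_y).
Qed.

Definition peel_inv s := exists l,
  [/\ peeled s l, up_spec (mem l) (fun v => s 12 (vid v)) & peel_pos s l].

Definition peel_measure (s : memory) := (n - s 20 0) + (n - s 22 0).

Lemma peel_step s : input_ok s -> ranks_ok s -> peel_inv s -> s 20 0 < n ->
  peel_inv (run peel_body s) /\ peel_measure (run peel_body s) < peel_measure s.
Proof.
move=> s_in s_rk [l [sl s_up [le_v pos skip]]] lt_v.
move: pos; rewrite lt_v => -[x s_u].
have size_le (l0 : seq V) : uniq l0 -> size l0 <= n.
  by move/card_uniqP <-; exact: max_card.
set t := run raise_limit (run peel_leaf s).
have -> : run peel_body s = if (s 8 (s 21 0) == 1) * (0 < s 21 0) != 0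
    then update t 21 0 (t 23 0) else update (update s 20 0 (s 20 0 + 1)) 21 0 (s 20 0 + 1) by [].
have -> : ((s 8 (s 21 0) == 1) * (0 < s 21 0) != 0) = (s 8 (vid x) == 1) && (x != root).
  by rewrite -(vid_eq numV_inj) root0 s_u; case: (_ == 1); case: (s 21 0).
case: ifP => [/andP[/eqP x_deg x_r]|x_deg]; last first.
  split; last by rewrite /peel_measure /=; lia.
  exists l; split; [by case: sl | by [] |].
  split; rewrite /= addn1 //.
    case: ltnP => [lt_v1|ge_v1]; last by lia.
    exact: num_surj.
  move=> w w_l w_r le_w ne_w; have [wx|wx] := eqVneq w x.
    by apply: contraFN x_deg; rewrite -wx => ->.
  by apply: skip => //; [lia | rewrite -s_u (vid_eq numV_inj)].
have [x_l y_l s1_p sl1 s1_8] := peel_leafP sl (esym s_u) x_r x_deg.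
set s1 := run peel_leaf s in t s1_p sl1 s1_8 *.
have fr1 : agree_off (writes peel_leaf) s s1 by exact: run_agree.
have in1 : input_ok s1 by exact: (input_ok_agree _ fr1 s_in).
have rk1 : ranks_ok s1 by move=> v w; rewrite fr1.
have [] := raise_limitP in1 rk1 erefl (etrans (fr1 21 0 isT) (esym s_u)) s1_p.
rewrite -/t => tc_off tc_p.
have fr2 : agree_off (writes raise_limit) s1 t by exact: run_agree.
split; last first.
  rewrite /peel_measure /= !fr2 //; have -> : s1 20 0 = s 20 0 by rewrite fr1.
  rewrite (peeled_size sl1) (peeled_size sl) /=.
  by have := size_le _ (peeled_uniq sl1); rewrite /=; lia.
exists (x :: l); split.
- case: sl1 => u1 u2 u3 u4 u5 u6 u7 u8 u9.
  by split=> //= *; rewrite fr2 //; auto.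
- exact: (up_spec_cons s_up).
- have s20 : t 20 0 = s 20 0 by rewrite fr2 // fr1.
  split; rewrite /= ?s20 ?lt_v // ?fr2 //.
    by exists (par x); rewrite s1_p.
  (* Only the degrees of [x] and of its parent have changed, and the parent is the vertex examined
     next. *)
  move=> w; rewrite inE negb_or => /andP[w_x w_l] w_r le_w; rewrite s1_p vid_eq // => w_y.
  by rewrite fr2 // s1_8 //; apply: skip => //; rewrite -s_u (vid_eq numV_inj).
Qed.

(* The unpeeled vertex of largest depth has only its parent as an unpeeled
   neighbour. *)
Lemma peel_all s l : peeled s l -> peel_pos s l -> n <= s 20 0 -> forall v, v != root -> v \in l.
Proof.
move=> sl [le_v pos skip] ge_v v v_r; apply/negPn/negP => v_l.
have s_u : s 21 0 = n by move: pos; rewrite ltnNge ge_v.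
have [par_adj adj_par] := parP.
case: (@arg_maxnP _ v [pred w | (w \notin l) && (w != root)] dep) => [|x /andP[x_l x_r] x_max].
  by rewrite /= v_l.
have x_v : vid x <= s 20 0 by rewrite (leq_trans (ltnW (vid_lt _ _))).
have x_u : vid x != s 21 0 by rewrite s_u ltn_eqF // vid_lt.
have /eqP[] := skip x x_l x_r x_v x_u.
rewrite (peeled_deg sl) (negbTE x_l) /unpeeled_sum (eq_bigl (pred1 (par x))) ?big_pred1_eq // => w.
apply/andP/eqP=> [[xw w_l]|->]; last first.
  by have [-> _] := par_adj x x_r; rewrite (peeled_par sl).
case: (adj_par _ _ xw) => [[_ ->//]|[w_r wE]].
have := x_max w; rewrite /= w_l w_r => /(_ isT).
by have [_] := par_adj w w_r; rewrite wE; lia.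
Qed.

Lemma peel_halts s : input_ok s -> ranks_ok s -> s 20 0 = 0 -> s 21 0 = 0 -> s 22 0 = 0 ->
    (forall i, s 12 i = 0) ->
    (forall v, s 8 (vid v) = \sum_(w | adj G v w) 1) ->
    (forall v, s 9 (vid v) = \sum_(w | adj G v w) vid w) ->
  halts peel_loop s ((n + n).+1 * (cost peel_cond + time peel_body).+1)
    (fun s' => exists l, [/\ peeled s' l, up_spec (mem l) (fun v => s' 12 (vid v)) &
       forall v, v != root -> v \in l]).
Proof.
move=> s_in s_rk s20 s21 s22 s12 s8 s9.
have n_gt0 : 0 < n by rewrite (leq_trans _ (vid_lt numV root)).
have inv0 : peel_inv s.
  exists [::]; split.
  - split=> // v *; rewrite (s8, s9) /=; apply: eq_bigl => w; by rewrite /= andbT.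
  - by split=> // u; rewrite s12.
  - rewrite /peel_pos s20 s21 n_gt0; split=> //; first by exists root.
    by move=> w _ w_r; rewrite leqn0 => ->.
have H := @halts_while peel_cond peel_body s peel_inv peel_measure isT inv0.
apply: halts_leq _ _ (H _); first by rewrite leq_mul2r ltnS /peel_measure s20 s22 !subn0 leqnn orbT.
  move=> s' fr [[l [sl s_up s_pos]] e0].
  have in' : input_ok s' by exact: (input_ok_agree _ fr s_in).
  move/eqP: e0; rewrite /= (in_n in') addn1 eqb0 -leqNgt => ge_v.
  by exists l; split=> //; apply: peel_all ge_v.
move=> s' fr inv; have in' : input_ok s' by exact: (input_ok_agree _ fr s_in).
move=> lt_v; apply: peel_step => //; first by move=> v w; rewrite fr.
by move: lt_v; rewrite /= (in_n in') addn1; case: leqP.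
Qed.

End Peel.

(** * Computing [t] from the root to the leaves and writing the output *)

Definition emit u : cmd :=
  let t := Get 13 u in
  let N := Op Add Vcount (Cst 1) in
  Set_ 6 u (Get 11 (Cell u (Op Defs.Sub t (Op Mul (Op Div t N) N)))).

Definition emit_root : cmd := Seq (SetVar 13 (Get 12 (Cst 0))) (emit (Cst 0)).

(** The peeling order is read backwards, so the time of a parent in array 13 is final when its
    children are treated. The two ranks enter [key] with their roles in [raise_limit] exchanged. *)
Definition settle : cmd :=
  Seq (Seq (Decr 22 (Cst 0) (Cst 1))
         (Seq (SetVar 21 (Get 15 (Var 22))) (SetVar 23 (Get 14 (Var 21)))))
   (Seq load_ranks
     (Seq (Seq (SetVar 26 (key (Get 13 (Var 23)) (Var 24) (Var 25)))
               (Set_ 13 (Var 21) (Get 12 (Var 21))))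
       (If (Var 25) (lower 13 (Var 21) (Var 26)) Skip))).

Definition emit_body : cmd := Seq settle (emit (Var 21)).

Definition emit_cond : expr := Var 22.

Definition emit_loop : cmd := Seq emit_root (While emit_cond emit_body).

Section Emit.
Variables (V0 S0 A : finType) (G : rotor_graph V0 S0 A) (rho : {ffun V0 -> A}).
Local Notation V := (V0 + S0)%type.
Local Notation n := #|{: V}|.
Variables (numV : V -> 'I_n) (numA : A -> 'I_#|A|).
Hypotheses (numV_inj : injective numV) (numA_inj : injective numA).
Hypotheses (G_simple : simple_graph G) (rho_cfg : rotor_config G rho).
Variables (root : V) (par : V -> V) (dep : V -> nat).
Hypothesis parP : parent_map (adj G) root par dep.
Local Notation vid := (vid numV).
Local Notation cell := (cell numV).
Local Notation rank := (rank G rho).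
Local Notation input_ok := (input_ok G rho numV numA).
Hypothesis root0 : vid root = 0.

Definition emitted (s : memory) v : Prop :=
  down_spec G rho root par (fun w => s 12 (vid w)) (fun w => s 13 (vid w)) v /\
  s 6 (vid v) = s 11 (vid v * n.+1 + s 13 (vid v) %% n.+1).

(* [l] lists the vertices that remain to be treated, the next one first. *)
Record pending (s : memory) (l : seq V) : Prop := Pending {
  pending_root : root \notin l;
  pending_par : forall v, v \notin l -> v != root -> par v \notin l;
  pending_order : pairwise (fun v w => par v != w) l;
  pending_uniq : uniq l;
  pending_size : s 22 0 = size l;
  pending_nth : forall i, i < size l -> s 15 i = vid (nth root (rev l) i);
  pending_emitted : forall v, v \notin l -> emitted s v
}.

Lemma subn_divM a N : a - a %/ N * N = a %% N.
Proof. by rewrite {1}(divn_eq a N) addKn. Qed.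

Lemma settleP s x m : input_ok s -> ranks_ok G rho numV s ->
    x != par x -> s 22 0 = m.+1 -> s 15 m = vid x -> s 14 (vid x) = vid (par x) ->
  let s1 := run settle s in
  [/\ s1 22 0 = m, s1 21 0 = vid x,
    forall v, v != x -> s1 13 (vid v) = s 13 (vid v) &
    s1 13 (vid x) =
      let tc w := s 12 (vid w) in
      let t w := s 13 (vid w) in
      if rank x (par x) != 0
      then minz (tc x) (back G rho par t x * n.+1 + rank x (par x)) else tc x].
Proof.
move=> s_in s_rk xy s22 s15 s14.
rewrite /settle /= s22 subn1 /= s15 s14.
rewrite !(in_n s_in) !addn1 -/(cell _ _) -/(cell _ _) !s_rk !eqxx.
have -> : (1 - (rank (par x) x == 0)) * ((s 13 (vid (par x)) + n - rank (par x) x) %/ n.+1)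
    = back G rho par (fun w => s 13 (vid w)) x.
  by rewrite /back /vis; case: eqP.
set c := _ + rank x (par x); have := eqxx (vid x).
have off v : v != x -> (vid v == vid x) = false by move=> /negbTE v_x; rewrite vid_eq.
case: ifP => _ /=; last by split=> // [v /off ->|]; rewrite ?eqxx.
rewrite addn_eq0 !eqb0 negb_and !negbK /minz.
by case: ifP => _ /=; split=> // [v /off ->|]; rewrite ?eqxx.
Qed.

(** The parent of [x] is already treated, by the peeling order. Conversely [x] is not the parent of
    a treated vertex, so the values [back] used before are unaffected by its new time. *)
Lemma emit_step s x l : input_ok s -> ranks_ok G rho numV s ->
    (forall v, v != root -> s 14 (vid v) = vid (par v)) ->
  pending s (x :: l) -> pending (run emit_body s) l.
Proof.
move=> s_in s_rk s14 [root_l l_par l_ord l_uniq sz s_nth em].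
have [x_r root_l'] : x != root /\ root \notin l.
  by move: root_l; rewrite inE negb_or eq_sym => /andP[].
have [par_adj _] := parP; have [_ lt_dep] := par_adj x x_r.
have xy : x != par x by apply: contraTneq lt_dep => <-; rewrite ltnn.
move: l_ord l_uniq; rewrite pairwise_cons cons_uniq.
move=> /andP[/allP x_ord l_ord] /andP[x_l l_uniq].
have y_l : par x \notin l by apply/negP => /x_ord; rewrite eqxx.
have s15 : s 15 (size l) = vid x.
  by rewrite s_nth // rev_cons nth_rcons size_rev ltnn eqxx.
have [s1_22 s1_21 s1_off s1_x] := settleP s_in s_rk xy sz s15 (s14 x x_r).
have -> : run emit_body s = run (emit (Var 21)) (run settle s) by [].
have fr1 : agree_off (writes settle) s (run settle s) by exact: run_agree.
move: (run settle s) fr1 s1_22 s1_21 s1_off s1_x => s1 fr1 s1_22 s1_21 s1_off s1_x.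
have n1 : s1 0 0 = n by rewrite fr1 // (in_n s_in).
have -> : run (emit (Var 21)) s1 =
    update s1 6 (vid x) (s1 11 (vid x * n.+1 + s1 13 (vid x) %% n.+1)).
  by rewrite /= s1_21 n1 addn1 subn_divM.
split=> //= [v v_l v_r|i lt_i|v v_l].
- have [->//|vx] := eqVneq v x.
  have v_xl : v \notin x :: l by rewrite inE negb_or vx.
  by have := l_par v v_xl v_r; rewrite inE negb_or => /andP[].
- rewrite fr1 // s_nth ?rev_cons ?nth_rcons ?size_rev ?lt_i //=; exact: ltnW.
have s12 w : s1 12 (vid w) = s 12 (vid w) by rewrite fr1.
have s13 : s1 13 (vid (par x)) = s 13 (vid (par x)) by rewrite s1_off // eq_sym.
have [->|vx] := eqVneq v x.
  by split=> /=; rewrite ?vid_eq // ?eqxx // /down_spec /= x_r s1_x s12 /back s13.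
have v_xl : v \notin x :: l by rewrite inE negb_or vx.
have [dn out] := em v v_xl; split=> /=; last first.
  by rewrite vid_eq // (negbTE vx) s1_off // !fr1.
rewrite /down_spec /= s1_off // s12 dn; case: eqVneq => //= v_r.
have := l_par v v_xl v_r; rewrite inE negb_or => /andP[pv_x _].
by rewrite /back s1_off.
Qed.

Lemma emit_halts s l : input_ok s -> ranks_ok G rho numV s -> peeled G numV root par s l ->
    (forall v, v != root -> v \in l) ->
  halts emit_loop s (time emit_root + n.+1 * (cost emit_cond + time emit_body).+1)
    (fun s' => forall v, emitted s' v).
Proof.
move=> s_in s_rk [l_uniq root_l l_par l_ord _ _ sz s_nth s_par] all_l.
have size_l : size l <= n by move/card_uniqP: l_uniq <-; exact: max_card.
apply: halts_seq.
  apply: (@halts_straight _ _ (fun s1 => pending s1 l)) => //.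
  split=> // v v_l; have -> : v = root by apply: contraNeq v_l => /all_l.
  split=> /=; first by rewrite /down_spec /= root0 !eqxx.
  by rewrite root0 (in_n s_in) addn1 subn_divM.
move=> s1 fr1 pend1; have in1 : input_ok s1 by exact: (input_ok_agree _ fr1 s_in).
have H := @halts_while emit_cond emit_body s1 (fun s' => exists l', pending s' l')
  (fun s' => s' 22 0) isT (ex_intro _ l pend1).
apply: halts_leq _ _ (H _).
- by rewrite leq_mul2r ltnS (pending_size pend1) size_l orbT.
- move=> s' fr [[l' pend] e0] v; apply: (pending_emitted pend).
  by move: e0; rewrite /= (pending_size pend) => /size0nil ->.
move=> s' fr [l' pend] ne0; have in' : input_ok s' by exact: (input_ok_agree _ fr in1).
case: l' pend => [|x l'] pend; first by move: ne0; rewrite /= (pending_size pend).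
have pend' : pending (run emit_body s') l'.
  apply: (emit_step (x := x)) => //; first by move=> v w; rewrite fr // fr1.
  by move=> v v_r; rewrite fr // fr1 // s_par // all_l.
split; first by exists l'.
by rewrite (pending_size pend') (pending_size pend) /=.
Qed.

End Emit.

(** * The number of arcs is linear in the number of vertices *)

Section ArcCount.
Variables (V0 S0 A : finType) (G : rotor_graph V0 S0 A).
Local Notation V := (V0 + S0)%type.
Hypothesis G_simple : simple_graph G.

Lemma adj_irr : irreflexive (adj G).
Proof.
move=> v; apply/orP => -[] /existsP[a /andP[/eqP ta /eqP ha]];
  by have := no_loop G a; rewrite ta ha eqxx.
Qed.

(** Every arc joins a vertex to its parent, so by simplicity its lower end and its direction
    determine it. *)
Lemma leq_card_arcs root par dep : parent_map (adj G) root par dep ->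
  #|A| <= 2 * #|{: V}|.
Proof.
move=> [_ adj_par].
pose up a := (atail G a != root) && (par (atail G a) == ahead G a).
pose f a := (if up a then atail G a else ahead G a, up a).
have f_inj : injective f.
  have downP a : ~~ up a -> par (ahead G a) = atail G a.
    have : adj G (atail G a) (ahead G a).
      by apply/orP; left; apply/existsP; exists a; rewrite !eqxx.
    by move/adj_par=> [[a_r aE]|[]//]; rewrite /up a_r aE eqxx.
  move=> a b; rewrite /f; case a_up: (up a); case b_up: (up b) => // -[ab].
    move: a_up b_up; rewrite /up => /andP[_ /eqP pa] /andP[_ /eqP pb].
    by apply: G_simple; rewrite // -pa -pb ab.
  apply: G_simple => //; rewrite -downP ?a_up // -(downP b) ?b_up //.
  by rewrite ab.
by have := leq_card f f_inj; rewrite card_prod card_bool mulnC.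
Qed.

End ArcCount.

(** * Assembly of the loops and the linear time bound *)

Definition forest_program : cmd :=
  Seq arcs_loop (Seq walk_loop (Seq peel_loop emit_loop)).

(** With [n] vertices, [#|A| <= 2 * n] and [1 <= n], the iteration bounds [#|A| + 1],
    [#|A| + n + 1], [n + n + 1] and [n + 1] are at most 3, 4, 3 and 2 times [n]. *)
Definition forest_factor : nat :=
  3 * (cost arcs_cond + time arcs_body).+1 +
  (time (SetVar 18 (Get 4 (Cst 0))) + 4 * (cost walk_cond + time walk_body).+1) +
  3 * (cost peel_cond + time peel_body).+1 +
  (time emit_root + 2 * (cost emit_cond + time emit_body).+1).

(* The program p and the constant c depend neither on the graph, nor on rho, nor
   on the numberings of the vertices and arcs. *)
Theorem theorem63 :
  exists (p : cmd) (c : nat),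
  forall (V0 S0 A : finType) (G : rotor_graph V0 S0 A)
         (rho : {ffun V0 -> A})
         (numV : V0 + S0 -> 'I_#|{: V0 + S0}|) (numA : A -> 'I_#|A|),
    simple_graph G -> stopping G -> tree_like G -> rotor_config G rho ->
    injective numV -> injective numA ->
  exists (D : {ffun V0 -> A}) (k : nat) (s : memory),
    unique (destination_forest G rho) D /\
    exec p (input_memory G rho numV numA) k s /\
    k <= c * #|{: V0 + S0}| /\
    outputs D numV numA s.
Proof.
exists forest_program, forest_factor.
move=> V0 S0 A G rho numV numA G_simple G_stop [[G_conn G_acyc] _] rho_cfg numV_inj numA_inj.
have n_gt0 : 0 < #|{: V0 + S0}|.
  by have /card_gt0P[x _] := has_sink G; apply/card_gt0P; exists (inr x).
(* The program takes as root the vertex numbered 0. *)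
have [root root0] := num_surj numV_inj n_gt0.
have [par [dep parP]] := tree_parent_map root (@adjC _ _ _ G) (adj_irr G) G_conn G_acyc.
have le_A := leq_card_arcs G_simple parP.
set s0 := input_memory G rho numV numA.
have in0 : input_ok G rho numV numA s0 by exact: input_memory_ok.
(* Here [tc] will be array 12 as the peeling leaves it; the last loop does not write this array. *)
pose Q (s : memory) := exists2 tc, up_spec G rho par tc [pred v | v != root] &
      [/\ forall v, tc v = s 12 (vid numV v),
         (forall u i, i < outdeg G rho u ->
            s 11 (vid numV (inl u) * #|{: V0 + S0}|.+1 + i.+1) =
              aid numA (iter i (rotor G) (rho u))) &
          forall v, emitted G rho numV root par s v].
have : halts forest_program s0 (forest_factor * #|{: V0 + S0}|) Q.
  apply: (@halts_leq _ _ (_ + (_ + (_ + _))) _ Q); last first.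
  - apply: halts_seq; first exact: (arcs_halts numV_inj numA_inj G_simple in0).
    move=> s1 fr1 [s1_8 s1_9].
    have in1 : input_ok G rho numV numA s1 by exact: (input_ok_agree _ fr1 in0).
    apply: halts_seq;
      first by apply: (walk_halts numV_inj G_simple rho_cfg in1) => // *; rewrite fr1.
    move=> s2 fr2 [s2_10 s2_11].
    have in2 : input_ok G rho numV numA s2 by exact: (input_ok_agree _ fr2 in1).
    apply: halts_seq.
      by apply: (peel_halts numV_inj parP root0 in2) => // *; rewrite fr2 // fr1.
    move=> s3 fr3 [l [sl s3_up all_l]].
    have in3 : input_ok G rho numV numA s3 by exact: (input_ok_agree _ fr3 in2).
    have rk3 : ranks_ok G rho numV s3 by move=> v w; rewrite fr3.
    apply: halts_leq (leqnn _) _ (emit_halts numV_inj parP root0 in3 rk3 sl all_l).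
    move=> s4 fr4 em4; exists (fun v => s3 12 (vid numV v)).
      have memE v : (v \in l) = (v != root).
        by apply/idP/idP=> [v_l|/all_l//]; apply: contraTneq v_l => ->; exact: peeled_root sl.
      have [up_le up_ex] := s3_up; split=> [c c_r|u u0]; first by apply: up_le; rewrite memE.
      have [c [c_l cP c_lim cE]] := up_ex u u0.
      by exists c; split; rewrite // inE -memE.
    split=> // [v|u i lt_i]; first by rewrite fr4.
    by rewrite fr4 // fr3 // s2_11.
  - by [].
  rewrite /forest_factor; move: n_gt0 le_A.
  move: (cost arcs_cond + _).+1 (cost walk_cond + _).+1
    (cost peel_cond + _).+1 (cost emit_cond + _).+1.
  move: (time _) (time _) #|A| #|{: V0 + S0}| => t t' m n c1 c2 c3 c4 n_gt0 le_m.
  nia.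
case=> k [s [exec_s le_k [_ [tc tcP [tcE s11 em]]]]].
have tP v : down_spec G rho root par tc (fun w => s 13 (vid numV w)) v.
  by have [] := em v; rewrite /down_spec tcE.
exists (turned G rho (turns G rho (fun w => s 13 (vid numV w)))), k, s; split.
  exact: (destination_forest_turns G_simple rho_cfg parP tcP tP G_stop G_acyc).
split=> //; split=> // u.
have [b [j [lt_j _ tE _]]] := t_turns G_simple rho_cfg parP tcP tP G_stop u.
rewrite (turnedE G_simple rho_cfg parP tcP tP G_stop) tE -/(vid numV (inl u)).
by have [_ ->] := em (inl u); rewrite tE s11.
Qed.
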